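(* Let $n\ge 3$, let $k\in\{0,1,-1\}$, and let $\mathcal L_+^{(k)}$ be the future light cone at the base point $o^{(k)}$ of the $(n+1)$-dimensional Minkowski ($k=0$), de Sitter ($k=1$), or anti-de Sitter ($k=-1$) spacetime, as described in the context. Let $\varphi:\mathcal L_+^{(k)}\to\mathcal L_+^{(k)}$ be an isometry. Then there is a unique Lorentz transformation $\tau\in O_+(1,n)$ such that $\tau^{(k)}|_{\mathcal L_+^{(k)}}=\varphi$.
   Context: All manifolds and maps are smooth. $\mathbb R^{1,n}$ is $\mathbb R^{n+1}$ with coordinates $(t,x)=(t,x_1,\dots,x_n)$ and the Minkowski metric $-dt^2+dx_1^2+\cdots+dx_n^2$; $\mathbb R^{2,n}$ is $\mathbb R^{n+2}$ with coordinates $(t_1,t_2,x_1,\dots,x_n)$ and metric $-dt_1^2-dt_2^2+dx_1^2+\cdots+dx_n^2$. Spacetimes and future light cones: - $k=0$: the spacetime is $\mathbb R^{1,n}$, $o^{(0)}$ is the origin, and $\mathcal L_+^{(0)}=\{(t,x)\in\mathbb R^{1,n} : -t^2+\|x\|^2=0,\ t>0\}$. - $k=1$: the de Sitter spacetime $dS_{n+1}$ is the hypersurface $-t^2+x_1^2+\cdots+x_{n+1}^2=1$ of $\mathbb R^{1,n+1}$ with the induced metric, $o^{(1)}=(0,\dots,0,1)$, and $\mathcal L_+^{(1)}=\{(t,x)\in dS_{n+1} : x_{n+1}=1,\ t>0\}$. - $k=-1$: the anti-de Sitter spacetime $AdS_{n+1}$ is the hypersurface $-t_1^2-t_2^2+x_1^2+\cdots+x_n^2=-1$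 of $\mathbb R^{2,n}$ with the induced metric, $o^{(-1)}=(1,0,\dots,0)$, and $\mathcal L_+^{(-1)}=\{(t_1,t_2,x)\in AdS_{n+1} : t_1=1,\ t_2>0\}$. Each $\mathcal L_+^{(k)}$ carries the (degenerate) symmetric bilinear form induced from the ambient spacetime. An isometry of $\mathcal L_+^{(k)}$ is a diffeomorphism of $\mathcal L_+^{(k)}$ onto itself whose pullback preserves this induced form. $O(1,n)$ is the group of linear isometries of $\mathbb R^{1,n}$ (Lorentz transformations), and $O_+(1,n)$ is its subgroup of Lorentz transformations preserving the time direction. For $\tau\in O_+(1,n)$, viewed as an $(n+1)\times(n+1)$ matrix, set $\tau^{(0)}=\tau$, $\tau^{(1)}=\begin{pmatrix}\tau&0\\0&1\end{pmatrix}\in O(1,n+1)$ (acting on $\mathbb R^{1,n+1}$ and preserving $dS_{n+1}$), and $\tau^{(-1)}=\begin{pmatrix}1&0\\0&\tau\end{pmatrix}\in O(2,n)$ (acting on $\mathbb R^{2,n}$ and preserving $AdS_{n+1}$). *)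

(* Defs.v *)
From mathcomp Require Import all_boot all_order all_algebra.
From mathcomp Require Import all_classical all_reals all_analysis.
Set Implicit Arguments.
Unset Strict Implicit.
Unset Printing Implicit Defensive.
Import Order.TTheory GRing.Theory Num.Theory.
Import numFieldNormedType.Exports.
Local Open Scope classical_set_scope.
Local Open Scope ring_scope.

(* C^k on an open set U. When V is finite-dimensional, continuity of every
   y |-> 'd f y v is the same as continuity of y |-> 'd f y in operator norm. *)
Fixpoint class_C (R : realType) (V W : normedModType R) (k : nat)
    (U : set V) (f : V -> W) {struct k} : Prop :=
  match k with
  | 0 => forall x, U x -> {for x, continuous f}
  | k'.+1 => (forall x, U x -> differentiable f x) /\
             (forall v, class_C k' U (fun y => 'd f y v))
  end.

Definition smooth (R : realType) (V W : normedModType R)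
    (U : set V) (f : V -> W) : Prop :=
  forall k, class_C k U f.

(* Below, an embedded submanifold of V is given by its underlying set S, and a
   map defined on S by a total function whose values outside S are ignored. *)
Definition smooth_on (R : realType) (V W : normedModType R)
    (S : set V) (f : V -> W) : Prop :=
  forall p, S p -> exists (U : set V) (F : V -> W),
    [/\ open U, U p, smooth U F & forall x, U x -> S x -> F x = f x].

Definition diffeomorphism (R : realType) (V : normedModType R)
    (S : set V) (f : V -> V) : Prop :=
  exists g : V -> V,
    [/\ (forall x, S x -> S (f x)) /\ (forall x, S x -> S (g x)),
        forall x, S x -> g (f x) = x,
        forall x, S x -> f (g x) = x,
        smooth_on S f & smooth_on S g].

Definition curve_at (R : realType) (V : normedModType R)
    (S : set V) (p : V) (c : R -> V) : Prop :=
  c 0 = p /\ exists2 e : R, 0 < e &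
    smooth ([set` `](- e), e[] : set R^o) (c : R^o -> V) /\
    forall t, t \in `](- e), e[ -> S (c t).

(* [differential S f p v w]: v is tangent to S at p, and the differential of
   f|_S at p maps v to w. *)
Definition differential (R : realType) (V W : normedModType R)
    (S : set V) (f : V -> W) (p v : V) (w : W) : Prop :=
  exists2 c : R -> V, curve_at S p c & derive1 c 0 = v /\ derive1 (f \o c) 0 = w.

(* The standard form of signature (p, m - p), with the negative directions
   first. *)
Definition pform (R : realType) (p m : nat) (u v : 'cV[R]_m) : R :=
  \sum_(i < m) (if (i < p)%N then - (u i 0 * v i 0) else u i 0 * v i 0).

Definition isometry_of (R : realType) (p m : nat)
    (S : set 'cV[R]_m.+1) (f : 'cV[R]_m.+1 -> 'cV[R]_m.+1) : Prop :=
  diffeomorphism S f /\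
  forall x v1 v2 w1 w2, S x ->
    differential S f x v1 w1 -> differential S f x v2 w2 ->
    pform p w1 w2 = pform p v1 v2.

Definition lorentz (R : realType) (n : nat) (tau : 'M[R]_n.+1) : Prop :=
  forall u v : 'cV[R]_n.+1, pform 1 (tau *m u) (tau *m v) = pform 1 u v.

Definition lorentz_plus (R : realType) (n : nat) (tau : 'M[R]_n.+1) : Prop :=
  lorentz tau /\
  forall u : 'cV[R]_n.+1,
    pform 1 u u < 0 -> 0 < u ord0 0 -> 0 < (tau *m u) ord0 0.

Inductive model := Minkowski | DeSitter | AntiDeSitter.

(* The ambient space has dimension [(ambient_pred k n).+1]; the successor is kept
   outside the match because only nonempty matrices are normed modules. The
   summands are ordered to fit the blocks of [extend]. *)
Definition ambient_pred (k : model) (n : nat) : nat :=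
  match k with
  | Minkowski => n
  | DeSitter => n + 1
  | AntiDeSitter => 1 + n
  end.

Definition negative_index (k : model) : nat :=
  match k with AntiDeSitter => 2 | _ => 1 end.

Definition spacetime (R : realType) (k : model) (n : nat) :
    set 'cV[R]_(ambient_pred k n).+1 :=
  match k with
  | Minkowski => setT
  | DeSitter => [set x | pform 1 x x = 1]
  | AntiDeSitter => [set x | pform 2 x x = -1]
  end.
Arguments spacetime : clear implicits.

Definition future_cone (R : realType) (k : model) (n : nat) :
    set 'cV[R]_(ambient_pred k n).+1 :=
  match k return set 'cV[R]_(ambient_pred k n).+1 with
  | Minkowski => [set x | pform 1 x x = 0 /\ 0 < x ord0 0]
  | DeSitter =>
      [set x | [/\ spacetime R DeSitter n x, x ord_max 0 = 1 & 0 < x ord0 0]]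
  | AntiDeSitter =>
      [set x | [/\ spacetime R AntiDeSitter n x, x ord0 0 = 1
                 & 0 < x (lift ord0 ord0) 0]]
  end.
Arguments future_cone : clear implicits.

Definition extend (R : realType) (k : model) (n : nat) (tau : 'M[R]_n.+1) :
    'M[R]_((ambient_pred k n).+1) :=
  match k return 'M[R]_((ambient_pred k n).+1) with
  | Minkowski => tau
  | DeSitter => block_mx tau 0 0 1%:M : 'M[R]_(n.+1 + 1)
  | AntiDeSitter => block_mx 1%:M 0 0 tau : 'M[R]_(1 + n.+1)
  end.

(* Main.v *)
From HB Require Import structures.
Require Import Defs.
From mathcomp Require Import all_boot all_order all_algebra.
From mathcomp Require Import all_classical all_reals all_analysis.
From mathcomp Require Import ring lra.
Import Order.TTheory GRing.Theory Num.Theory.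
Import numFieldNormedType.Exports.
Set Implicit Arguments.
Unset Strict Implicit.
Unset Printing Implicit Defensive.
Local Open Scope classical_set_scope.
Local Open Scope ring_scope.

(** Write <,> for the Minkowski form and L for the future null cone of R^{1,n}.
    In each of the three models the cone is an affine isometric copy of L
    ([future_coneE], [pform_chart]), so everything reduces to an isometry f of
    the degenerate form of L.

    The content is that f preserves <,> on all pairs of points of L, not only on
    tangent vectors at one point; since L spans R^{1,n} and <,> is nondegenerate,
    f is then the restriction of a linear isometry
    ([lightlike_isometry_linear]). In terms of the sphere of null directions this
    is the rigidity of conformal diffeomorphisms of S^(n-1); the proof below is a
    maximum principle that treats all n >= 3 alike, and uses neither Liouville's
    theorem nor complex analysis.

    First, f is homogeneous of degree one ([homogeneous]): the image of a ray has
    null tangents, hence is part of a ray, and the speed along it is dictated by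
    the scaling of the induced form.

    Next, take e, e' in L with <e,e'> = -1. The horosphere
    u |-> e + u + <u,u>/2 e', for u orthogonal to e and e', is a flat Euclidean
    section of L, so G(u) = f(horosphere u) is a flat immersed submanifold of
    R^{1,n} lying in L. Vanishing of its Christoffel symbols and the Gauss
    equation force W = D_1 D_1 G + D_2 D_2 G, for any orthonormal directions 1
    and 2, to be a null vector with <W,G> = -2, that is, a future null vector
    ([laplacian_flat_image]). Hence h(u) = -<G(u), f(e')> satisfies
    D_1 D_1 h + D_2 D_2 h = -<W, f(e')> >= 0: it is subharmonic on every
    2-plane, which exists because n >= 3. At infinity h tends to 1: the inversion
    u |-> 2u/<u,u> exchanges the horospheres based at e and e', homogeneity turns
    h into a difference quotient of f at e', and f is isometric there
    ([horosphere_plane_bound]). The maximum principle gives h(0) <= 1, which is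
    <x,y> <= <f x, f y> ([mink_bound]). The inverse of f is an isometry too, and
    the same inequality for it is the reverse one. *)

(** * Calculus of C^k maps *)

Lemma cV_sum_delta {R : realType} m (v : 'cV[R]_m) :
  v = \sum_i v i 0 *: delta_mx i 0.
Proof.
apply/colP => i; rewrite summxE (bigD1 i) //= big1 => [|j ji].
  by rewrite !mxE !eqxx mulr1 addr0.
by rewrite !mxE eq_sym (negbTE ji) mulr0.
Qed.

Section ClassC.
Context {R : realType}.
Implicit Types V W : normedModType R.

Lemma near_eq_diff V W (f g : V -> W) (x : V) :
    (\near x, f x = g x) -> differentiable f x ->
  differentiable g x /\ 'd g x = 'd f x :> (V -> W).
Proof.
move=> fg df.
have dg : g \o shift x = cst (g x) + 'd f x +o_ 0 id.
  apply: eqaddoE; apply/eqaddoP => e e0.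
  have /diff_locally/eqaddoE/eqaddoP/(_ e e0) := df.
  have fg0 : \forall y \near (0 : V), f (y + x) = g (y + x).
    by move: fg; rewrite (near_shift 0) subr0.
  have fgx : f x = g x by exact: nbhs_singleton fg.
  move=> H; apply: filterS2 fg0 H => y fgy.
  by rewrite /= !fctE /= fgy fgx.
have dcf := diff_continuous df.
have dE : 'd g x = 'd f x :> (V -> W) by exact: diff_unique dcf dg.
split; last exact: dE.
by apply/diff_locallyP; rewrite dE.
Qed.

Lemma class_C_sub V W k (U U' : set V) (f : V -> W) :
  U `<=` U' -> class_C k U' f -> class_C k U f.
Proof.
move=> UU; elim: k f => [|k IH] f /=; first by move=> h x /UU/h.
by move=> [h1 h2]; split=> [x /UU/h1//|v]; exact: IH.
Qed.

Lemma class_C_local V W k (U : set V) (f : V -> W) :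
  (forall x, U x -> exists N : set V, N x /\ class_C k N f) -> class_C k U f.
Proof.
elim: k f => [|k IH] f h /=; first by move=> x /h[N [Nx]]; exact.
split=> [x /h[N [Nx []]]|v]; first by move=> df _; exact: df.
by apply: IH => x /h[N [Nx [_ Nf]]]; exists N; split; last exact: Nf.
Qed.

(** Openness is what lets the differentials of [f] and [g] agree on [U], so that
    the induction on the order goes through. *)
Lemma eq_class_C V W k (U : set V) (f g : V -> W) :
  open U -> (forall x, U x -> f x = g x) -> class_C k U f -> class_C k U g.
Proof.
move=> oU; have nearU x : U x -> \near x, U x by move=> Ux; exact: open_nbhs_nbhs.
elim: k f g => [|k IH] f g fg /=.
  move=> cf x Ux; have cfx : f @ x --> f x := cf x Ux.
  change (g @ x --> g x); rewrite -(fg x Ux).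
  apply: cvg_trans cfx; apply: near_eq_cvg.
  by apply: filterS (nearU x Ux) => y /fg.
have nfg x : U x -> \near x, f x = g x.
  by move=> Ux; apply: filterS (nearU x Ux) => y /fg.
move=> [df dcf]; split=> [x Ux|v].
  by have [] := near_eq_diff (nfg x Ux) (df x Ux).
apply: IH (dcf v) => x Ux.
have [_ E] := near_eq_diff (nfg x Ux) (df x Ux).
exact: (esym (congr1 (fun h : V -> W => h v) E)).
Qed.

Lemma class_CS V W k (U : set V) (f : V -> W) : class_C k.+1 U f -> class_C k U f.
Proof.
elim: k f => [|k IH] f.
  by move=> [df _] x /df; exact: differentiable_continuous.
by move=> [df dcf]; split=> // v; exact/IH/dcf.
Qed.

Lemma class_C_cst V W k (U : set V) (a : W) : class_C k U (cst a).
Proof.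
elim: k a => [|k IH] a /=; first by move=> x _; exact: cst_continuous.
split=> [x _|v]; first exact: differentiable_cst.
rewrite (_ : (fun y => _) = cst 0) //; apply/funext => y.
by rewrite diff_cst.
Qed.

Lemma class_C_lin V W k (U : set V) (f : {linear V -> W}) :
  continuous f -> class_C k U f.
Proof.
move=> cf; case: k => [|k] /=; first by move=> x _; exact: cf.
split=> [x _|v]; first exact: linear_differentiable.
rewrite (_ : (fun y => _) = cst (f v)); first exact: class_C_cst.
by apply/funext => y; rewrite diff_lin.
Qed.

Lemma class_CD V W k (U : set V) (f g : V -> W) : open U ->
  class_C k U f -> class_C k U g -> class_C k U (fun x => f x + g x).
Proof.
move=> oU; elim: k f g => [|k IH] f g /=.
  by move=> cf cg x Ux; apply: continuousD; [exact: cf|exact: cg].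
move=> [df dcf] [dg dcg]; split=> [x Ux|v].
  by apply: differentiableD; [exact: df|exact: dg].
apply: eq_class_C (IH _ _ (dcf v) (dcg v)) => // x Ux.
exact: (esym (congr1 (fun h : V -> W => h v) (diffD (df x Ux) (dg x Ux)))).
Qed.

Lemma class_C_sum V W k (U : set V) n (f : 'I_n -> V -> W) : open U ->
  (forall i, class_C k U (f i)) -> class_C k U (fun x => \sum_(i < n) f i x).
Proof.
move=> oU; elim: n f => [|n IH] f Cf.
  rewrite (_ : (fun x => _) = cst 0); first exact: class_C_cst.
  by apply/funext => x; rewrite big_ord0.
rewrite (_ : (fun x => _) =
    (fun x => \sum_(i < n) f (widen_ord (leqnSn n) i) x + f ord_max x)).
  by apply: class_CD => //; exact: IH.
by apply/funext => x; rewrite big_ord_recr.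
Qed.

Lemma class_C_linl V W (Z : normedModType R) k (U : set V) (L : {linear W -> Z})
  (f : V -> W) : open U -> continuous L ->
  class_C k U f -> class_C k U (fun x => L (f x)).
Proof.
move=> oU cL; elim: k f => [|k IH] f /=.
  by move=> cf x Ux; apply: continuous_comp; [exact: cf|exact: cL].
move=> [df dcf]; split=> [x Ux|v].
  apply: differentiable_comp; first exact: df.
  exact: linear_differentiable.
apply: eq_class_C (IH _ (dcf v)) => // x Ux.
rewrite (@diff_comp _ _ _ _ f L) /=; [|exact: df|exact: linear_differentiable].
by rewrite diff_lin.
Qed.

Lemma class_CM V k (U : set V) (f g : V -> R) : open U ->
  class_C k U f -> class_C k U g -> class_C k U (fun x => f x * g x).
Proof.
move=> oU; elim: k f g => [|k IH] f g.
  by move=> cf cg x Ux; apply: continuousM; [exact: cf|exact: cg].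
move=> Cf Cg; have [df dcf] := Cf; have [dg dcg] := Cg; split=> [x Ux|v].
  by apply: differentiableM; [exact: df|exact: dg].
apply: eq_class_C (class_CD oU (IH _ _ (class_CS Cf) (dcg v))
                           (IH _ _ (class_CS Cg) (dcf v))) => // x Ux.
exact: (esym (congr1 (fun h : V -> R => h v) (diffM (df x Ux) (dg x Ux)))).
Qed.

Lemma class_C_coord V m k (U : set V) (f : V -> 'cV[R]_m.+1) i : open U ->
  class_C k U f -> class_C k U (fun x => f x i 0).
Proof.
move=> oU; have lin : linear (fun N : 'cV[R]_m.+1 => N i 0 : R^o).
  by move=> a u v; rewrite !mxE.
pose lM := GRing.isLinear.Build _ _ _ _ _ lin.
pose L : {linear 'cV[R]_m.+1 -> R^o} := HB.pack (fun N : 'cV[R]_m.+1 => N i 0) lM.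
apply: (@class_C_linl _ _ _ _ _ L) => //.
exact: coord_continuous.
Qed.

Lemma class_C_cV V m k (U : set V) (f : V -> 'cV[R]_m.+1) : open U ->
  (forall i, class_C k U (fun x => f x i 0)) -> class_C k U f.
Proof.
move=> oU Cf.
rewrite (_ : f = fun x => \sum_i f x i 0 *: delta_mx i 0); last first.
  by apply/funext => x; exact: cV_sum_delta.
apply: class_C_sum => // i; set e := delta_mx i 0.
have lin : linear (fun a : R^o => a *: e : 'cV[R]_m.+1).
  by move=> a u v; rewrite scalerDl scalerA.
pose lM := GRing.isLinear.Build _ _ _ _ _ lin.
pose L : {linear R^o -> 'cV[R]_m.+1} := HB.pack (fun a : R^o => a *: e) lM.
by apply: (@class_C_linl _ _ _ _ _ L) => //; exact: scalel_continuous.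
Qed.

Lemma diff_cV_sum V m (f : 'cV[R]_m.+1 -> V) x v :
  'd f x v = \sum_i v i 0 *: 'd f x (delta_mx i 0).
Proof.
rewrite {1}(cV_sum_delta v).
by rewrite linear_sum; apply: eq_bigr => i _; rewrite linearZ.
Qed.

(** The differential of the composite is expanded on the canonical basis, which
    separates the chain rule into products of coordinates of ['d f] with partial
    derivatives of [F]; to both the induction hypothesis applies. *)
Lemma class_C_comp V m p k (U : set V) (T : set 'cV[R]_m.+1)
    (F : 'cV[R]_m.+1 -> 'cV[R]_p.+1) (f : V -> 'cV[R]_m.+1) :
    open U -> open T -> (forall x, U x -> T (f x)) ->
  class_C k T F -> class_C k U f -> class_C k U (fun x => F (f x)).
Proof.
move=> oU oT fT; elim: k F => [|k IH] F.
  move=> cF cf x Ux; apply: continuous_comp; first exact: cf.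
  by apply: cF; exact: fT.
move=> [dF dCF] Cf; have [df dCf] := Cf; split=> [x Ux|v].
  by apply: differentiable_comp; [exact: df|apply/dF/fT].
apply: (@eq_class_C _ _ _ _
  (fun x => \sum_i ('d f x v) i 0 *: 'd F (f x) (delta_mx i 0))) => //.
  move=> x Ux; have E := diff_comp (df x Ux) (dF _ (fT x Ux)).
  by rewrite -diff_cV_sum; exact: (esym (congr1 (fun h : V -> 'cV_p.+1 => h v) E)).
apply: class_C_sum => // i; apply: class_C_cV => // j.
rewrite (_ : (fun x => _) =
    fun x => ('d f x v) i 0 * ('d F (f x) (delta_mx i 0)) j 0); last first.
  by apply/funext => x; rewrite mxE.
apply: class_CM => //; apply: class_C_coord => //.
  exact: dCf.
exact: (IH (fun y => 'd F y (delta_mx i 0)) (dCF _) (class_CS Cf)).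
Qed.

End ClassC.

(** * Globally smooth maps and their directional derivatives *)

Section Smooth.
Context {R : realType}.
Implicit Types V W : normedModType R.

Lemma smooth_differentiable V W (f : V -> W) u :
  smooth setT f -> differentiable f u.
Proof. by move=> sf; have [df _] := sf 1%N; exact: df. Qed.

Lemma smooth_continuous V W (f : V -> W) : smooth setT f -> continuous f.
Proof. by move=> sf u; exact: (sf 0%N u). Qed.

Lemma smooth_derivable V W (f : V -> W) u v : smooth setT f -> derivable f u v.
Proof. by move=> sf; apply/diff_derivable/smooth_differentiable. Qed.

Lemma smooth_derive V W (f : V -> W) v :
  smooth setT f -> smooth setT (fun u => 'D_v f u).
Proof.
move=> sf k; have [df dCf] := sf k.+1.
apply: eq_class_C (dCf v) => [|u _]; first exact: openT.
by rewrite deriveE //; exact: df.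
Qed.

Lemma smooth_coord V m (f : V -> 'cV[R]_m.+1) i :
  smooth setT f -> smooth setT (fun u => f u i 0).
Proof. by move=> sf k; apply: class_C_coord => //; exact: openT. Qed.

Lemma smooth_cV V m (f : V -> 'cV[R]_m.+1) :
  (forall i, smooth setT (fun u => f u i 0)) -> smooth setT f.
Proof. by move=> sf k; apply: class_C_cV => [|i]; [exact: openT|exact: sf]. Qed.

Lemma smooth_cst V W (a : W) : smooth (setT : set V) (fun _ => a).
Proof. by move=> k; exact: class_C_cst. Qed.

Lemma smoothD V W (f g : V -> W) :
  smooth setT f -> smooth setT g -> smooth setT (fun u => f u + g u).
Proof. by move=> sf sg k; apply: class_CD => //; exact: openT. Qed.

Lemma smoothM V (f g : V -> R) :
  smooth setT f -> smooth setT g -> smooth setT (fun u => f u * g u).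
Proof. by move=> sf sg k; apply: class_CM => //; exact: openT. Qed.

Lemma smooth_sum V W n (f : 'I_n -> V -> W) :
  (forall i, smooth setT (f i)) -> smooth setT (fun u => \sum_(i < n) f i u).
Proof.
by move=> sf k; apply: class_C_sum => [|i]; [exact: openT|exact: sf].
Qed.

Lemma smoothZ V m (a : V -> R) (f : V -> 'cV[R]_m.+1) :
  smooth setT a -> smooth setT f -> smooth setT (fun u => a u *: f u).
Proof.
move=> sa sf; apply: smooth_cV => i.
rewrite (_ : (fun u => _) = fun u => a u * f u i 0).
  by apply: smoothM => //; exact: smooth_coord.
by apply/funext => u; rewrite mxE.
Qed.

Lemma smooth_id V : smooth (setT : set V) (fun u => u).
Proof. by move=> k; apply: (@class_C_lin _ _ _ _ _ idfun) => u; exact: cvg_id. Qed.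

Lemma smooth_mulmx V p q (A : 'M[R]_(p.+1, q.+1)) (f : V -> 'cV[R]_q.+1) :
  smooth setT f -> smooth setT (fun u => A *m f u).
Proof.
move=> sf; apply: smooth_cV => i.
rewrite (_ : (fun u => _) = fun u => \sum_j A i j * f u j 0).
  apply: smooth_sum => j; apply: smoothM; first exact: smooth_cst.
  exact: smooth_coord.
by apply/funext => u; rewrite mxE.
Qed.

(** A map that is only smooth on [S] becomes smooth in the ordinary sense once it
    is precomposed with a smooth family of points of [S]: near each parameter it
    may be replaced by a local extension. *)
Lemma smooth_on_comp V m p (S : set 'cV[R]_m.+1)
    (f : 'cV[R]_m.+1 -> 'cV[R]_p.+1) (psi : V -> 'cV[R]_m.+1) :
  smooth_on S f -> smooth setT psi -> (forall u, S (psi u)) ->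
  smooth setT (fun u => f (psi u)).
Proof.
move=> sf spsi Spsi k; apply: class_C_local => u _.
have [U [F [oU Uu sF FE]]] := sf _ (Spsi u).
have oN : open (psi @^-1` U).
  by by move/continuousP: (smooth_continuous spsi); apply.
exists (psi @^-1` U); split=> //.
apply: (@eq_class_C _ _ _ _ _ (fun x => F (psi x))) => // [x Ux|].
  exact: FE.
apply: (class_C_comp oN oU) => //.
exact: (class_C_sub (@subsetT _ _) (spsi k)).
Qed.

Lemma is_derive_line V W (f : V -> W) u v (t : R) : smooth setT f ->
  is_derive t 1 (fun s : R => f (u + s *: v)) ('D_v f (u + t *: v)).
Proof.
move=> sf; have E : (fun h : R => h^-1 *: (((fun s : R => f (u + s *: v)) \o shift t)
      (h *: 1) - f (u + t *: v))) =
    (fun h : R => h^-1 *: ((f \o shift (u + t *: v)) (h *: v) - f (u + t *: v))).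
  apply/funext => h /=.
  by rewrite [h%:A](mulr1) scalerDl addrCA.
apply: DeriveDef; last by rewrite /derive E.
by rewrite /derivable E; exact: smooth_derivable.
Qed.

Lemma derive_coord V m (f : V -> 'cV[R]_m.+1) u v i :
  smooth setT f -> 'D_v f u i 0 = 'D_v (fun x => f x i 0) u.
Proof. by move=> sf; rewrite derive_mx ?mxE //; exact: smooth_derivable. Qed.

End Smooth.
(** * Second derivatives: symmetry and the maximum principle *)

Section RealLine.
Context {R : realType}.

Lemma mean_value (g dg : R -> R) (a b : R) :
    (forall t : R, is_derive t 1 g (dg t)) -> a < b ->
  exists2 c, a < c < b & g b - g a = dg c * (b - a).
Proof.
move=> dgE ab; have cg : {within `[a, b], continuous g}.
  apply: continuous_subspaceT => t; apply: differentiable_continuous.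
  by apply/derivable1_diffP; have [] := dgE t.
have [c cab E] := MVT ab (fun t _ => dgE t) cg.
by exists c => //; rewrite in_itv in cab.
Qed.

Lemma derive0_cst (g : R -> R) :
  (forall t : R, is_derive t 1 g 0) -> forall a b, g a = g b.
Proof.
move=> dg; suff H a b : a < b -> g a = g b.
  by move=> a b; case: (ltgtP a b) => [/H//|/H->//|->].
move=> ab; have [c _] := mean_value dg ab.
by rewrite mul0r => /eqP; rewrite subr_eq0 => /eqP.
Qed.

Lemma second_derivative_le0 (g dg ddg : R -> R) (a b c : R) :
    (forall t : R, is_derive t 1 g (dg t)) ->
    (forall t : R, is_derive t 1 dg (ddg t)) -> {for c, continuous ddg} ->
    a < c < b -> (forall t, a < t < b -> g t <= g c) -> ddg c <= 0.
Proof.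
move=> gE dgE cddg /andP[ac cb] cmax; rewrite leNgt; apply/negP => ddg0.
have dg0 : dg c = 0.
  have [||||_ <-] := @derive1_at_max _ g a b c.
  - exact/ltW/(lt_trans ac).
  - by move=> t _; have [] := gE t.
  - by rewrite in_itv /= ac.
  - by move=> t; rewrite in_itv; exact: cmax.
  by apply/esym; have [] := gE c.
have : \forall t \near c, 0 < ddg t.
  by move/cvgr_gt : cddg; apply.
move=> /nbhs_ballP[d /= d0 Hd].
pose t := c + Num.min d (b - c) / 2.
have m0 : 0 < Num.min d (b - c) by rewrite lt_min d0 subr_gt0.
have ct : c < t by rewrite /t ltrDl divr_gt0.
have tb : t < b.
  have : Num.min d (b - c) <= b - c by rewrite ge_min lexx orbT.
  rewrite /t; lra.
have td : t < c + d.
  have : Num.min d (b - c) <= d by rewrite ge_min lexx.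
  rewrite /t; lra.
have [x /andP[cx xt] Ex] := mean_value gE ct.
have [y /andP[cy yx] Ey] := mean_value dgE cx.
have y0 : 0 < ddg y.
  apply: Hd; rewrite -ball_normE /= distrC ger0_norm; last by rewrite subr_ge0 ltW.
  lra.
have : g t <= g c by apply: cmax; rewrite tb (lt_trans ac).
apply/negP; rewrite -ltNge -subr_gt0 Ex mulr_gt0 ?subr_gt0 //.
by move: Ey; rewrite dg0 subr0 => ->; rewrite mulr_gt0 // subr_gt0.
Qed.

End RealLine.

Section Symmetry.
Context {R : realType} {V : normedModType R}.

(** Two applications of the mean value theorem. The left-hand side is symmetric in
    [v] and [w], whence the symmetry of second derivatives. *)
Lemma second_difference (f : V -> R) x v w (h : R) : smooth setT f -> 0 < h ->
  exists a b : R, [/\ 0 <= a <= h, 0 <= b <= h &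
    f (x + h *: v + h *: w) - f (x + h *: v) - f (x + h *: w) + f x =
    h ^+ 2 * 'D_w (fun u => 'D_v f u) (x + a *: v + b *: w)].
Proof.
move=> sf h0; have sdf := smooth_derive v sf.
have dg (t : R) : is_derive t 1
    (fun s => f ((x + h *: w) + s *: v) - f (x + s *: v))
    ('D_v f ((x + h *: w) + t *: v) - 'D_v f (x + t *: v)).
  by apply: is_deriveB; exact: is_derive_line.
have [a /andP[a0 ah] Ea] := mean_value dg h0.
have [b /andP[b0 bh] Eb] := mean_value (fun t => is_derive_line (x + a *: v) w t sdf) h0.
exists a, b; split; [by rewrite !ltW|by rewrite !ltW|].
move: Ea Eb; rewrite !scale0r !addr0 !subr0; set X := 'D_w _ _ => Ea Eb.
rewrite (addrAC x (h *: w) (h *: v)) (addrAC x (h *: w) (a *: v)) Eb in Ea.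
by rewrite expr2 mulrC mulrA -Ea opprB addrA [RHS]addrAC.
Qed.

Lemma deriveC_real (f : V -> R) x v w : smooth setT f ->
  'D_w (fun u => 'D_v f u) x = 'D_v (fun u => 'D_w f u) x.
Proof.
move=> sf; set p := fun u => 'D_w (fun u => 'D_v f u) u.
set q := fun u => 'D_v (fun u => 'D_w f u) u; change (p x = q x).
have cp : p @ x --> p x.
  by apply: smooth_continuous; do 2 apply: smooth_derive.
have cq : q @ x --> q x.
  by apply: smooth_continuous; do 2 apply: smooth_derive.
apply/eqP; rewrite -subr_eq0 -normr_le0; apply/ler_addgt0Pr => e e0; rewrite add0r.
have e20 : 0 < e / 2 by rewrite divr_gt0.
move/cvgrPdist_lt : cp => /(_ _ e20)/nbhs_ballP[d1 /= d10 Hp].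
move/cvgrPdist_lt : cq => /(_ _ e20)/nbhs_ballP[d2 /= d20 Hq].
pose d := Num.min d1 d2; have d0 : 0 < d by rewrite lt_min d10.
pose h := d / (2 * (`|v| + `|w| + 1)).
have n0 : 0 < `|v| + `|w| + 1 by rewrite ltr_wpDl ?addr_ge0.
have h0 : 0 < h by rewrite divr_gt0 // mulr_gt0.
have hd : h * (`|v| + `|w|) < d.
  rewrite /h mulrAC ltr_pdivrMr ?mulr_gt0 // ltr_pM2l //; lra.
have small a b : 0 <= a <= h -> 0 <= b <= h -> ball x d (x + a *: v + b *: w).
  move=> /andP[a0 ah] /andP[b0 bh]; rewrite -ball_normE /= -addrA opprD addrA subrr add0r.
  rewrite normrN; apply: le_lt_trans hd; apply: le_trans (ler_normD _ _) _.
  by rewrite !normrZ !ger0_norm // mulrDr lerD // ler_wpM2r.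
have [a [b [ah bh Eab]]] := second_difference x v w sf h0.
have [b' [a' [bh' ah' Eab']]] := second_difference x w v sf h0.
have pq : p (x + a *: v + b *: w) = q (x + a' *: v + b' *: w).
  have h20 : h ^+ 2 != 0 by rewrite expf_neq0 // gt_eqF.
  rewrite [X in q X]addrAC; apply: (mulfI h20).
  apply: etrans (esym Eab) (etrans _ Eab'); congr (_ + _).
  by rewrite addrAC; congr (f _ - _ - _); exact: addrAC.
have bp : `|p x - p (x + a *: v + b *: w)| < e / 2.
  by apply: Hp; apply: le_ball (small _ _ ah bh); rewrite ge_min lexx.
have bq : `|q x - q (x + a' *: v + b' *: w)| < e / 2.
  by apply: Hq; apply: le_ball (small _ _ ah' bh'); rewrite ge_min lexx orbT.
move: bp bq; rewrite pq; move: (p x) (q x) (q _) => X Y r bp bq.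
rewrite (_ : X - Y = (X - r) - (Y - r)); last by ring.
by apply: le_trans (ler_normB _ _) _; rewrite (splitr e); exact/ltW/ltrD.
Qed.

Lemma deriveC m (f : V -> 'cV[R]_m.+1) x v w : smooth setT f ->
  'D_w (fun u => 'D_v f u) x = 'D_v (fun u => 'D_w f u) x.
Proof.
move=> sf; apply/colP => i.
have E z : (fun u => 'D_z f u i 0) = (fun u => 'D_z (fun y => f y i 0) u).
  by apply/funext => u; exact: derive_coord.
have E2 y z : 'D_z (fun u => 'D_y f u) x i 0 =
    'D_z (fun u => 'D_y (fun y => f y i 0) u) x.
  by rewrite -E; exact: (derive_coord _ _ _ (smooth_derive _ sf)).
apply: etrans (E2 v w) (etrans _ (esym (E2 w v))).
by apply: deriveC_real; exact: smooth_coord.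
Qed.

End Symmetry.

Section MaximumPrinciple.
Context {R : realType} {V : normedModType R}.

(** Adding a small multiple of the strictly subharmonic s^2 + t^2 makes the
    Laplacian positive, so that an interior maximum over a large square is
    impossible; on the boundary of the square the hypothesis at infinity bounds
    [f]. *)
Lemma plane_maximum_principle (f : V -> R) (e1 e2 : V) (c : R) :
    smooth setT f ->
    (forall u, 0 <= 'D_e1 (fun y => 'D_e1 f y) u + 'D_e2 (fun y => 'D_e2 f y) u) ->
    (forall e, 0 < e -> exists2 rho, 0 < rho & forall s t : R,
       rho <= Num.max `|s| `|t| -> f (s *: e1 + t *: e2) <= c + e) ->
  f 0 <= c.
Proof.
move=> sf lap bdry; rewrite leNgt; apply/negP => cf.
pose e := (f 0 - c) / 2; have e0 : 0 < e by rewrite divr_gt0 // subr_gt0.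
have [rho rho0 Hrho] := bdry e e0.
(* The perturbation is at most 2 eta rho^2 = e / 2 on the square. *)
pose eta := e / (4 * rho ^+ 2).
have eta0 : 0 < eta by rewrite divr_gt0 // mulr_gt0 // exprn_gt0.
have eta_rho : eta * (rho ^+ 2) * 4 = e.
  by rewrite /eta; field; rewrite gt_eqF.
pose g (p : R * R) : R := f (p.1 *: e1 + p.2 *: e2) + eta * (p.1 ^+ 2 + p.2 ^+ 2).
have cg : continuous g.
  move=> p; apply: cvgD.
    apply: continuous_comp; last exact: smooth_continuous.
    by apply: cvgD; apply: cvgZr_tmp; [exact: cvg_fst|exact: cvg_snd].
  apply: cvgM; first exact: cvg_cst.
  apply: cvgD; apply: (@continuous_comp _ _ _ _ (fun x : R => x ^+ 2));
   by [exact: cvg_fst|exact: cvg_snd|exact: exprn_continuous].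
pose A : set (R * R) := `[- rho, rho] `*` `[- rho, rho].
have A0 : A !=set0 by exists (0, 0); split; rewrite /= in_itv /=; lra.
have cA : compact A by apply: compact_setX; exact: segment_compact.
have [[a b] /set_mem[/= + +] gmax] := compact_EVT_max A0 cA (continuous_subspaceT cg).
rewrite !in_itv /= => arho brho.
have g00 : f 0 <= g (a, b).
  apply: le_trans (gmax (0, 0) _).
    by rewrite /g /= !scale0r addr0 expr0n /= addr0 mulr0 addr0.
  by apply/mem_set; split; rewrite /= in_itv /=; lra.
have sq_le x : - rho <= x <= rho -> x ^+ 2 <= rho ^+ 2.
  move=> xr; have : 0 <= (rho - x) * (rho + x) by apply: mulr_ge0; lra.
  rewrite -subr_ge0; have -> : (rho - x) * (rho + x) = rho ^+ 2 - x ^+ 2 by ring.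
  by [].
have interior : Num.max `|a| `|b| < rho.
  rewrite ltNge; apply/negP => /Hrho fab.
  have : eta * (a ^+ 2 + b ^+ 2) <= e / 2.
    rewrite (_ : e / 2 = eta * (rho ^+ 2 + rho ^+ 2)); last by rewrite -eta_rho; field.
    by rewrite ler_pM2l // lerD // sq_le.
  by move: g00; rewrite /g /=; rewrite /e in e0 fab *; lra.
move: interior; rewrite gt_max !ltr_norml => /andP[ar br].
have test (u v : V) (r k : R) : - rho < r < rho ->
    (forall t, - rho < t < rho -> f (u + t *: v) + eta * (t ^+ 2 + k) <=
       f (u + r *: v) + eta * (r ^+ 2 + k)) ->
    'D_v (fun y => 'D_v f y) (u + r *: v) + eta * 2 <= 0.
  move=> rr rmax.
  have d1 (t : R) : is_derive t 1 (fun s => f (u + s *: v) + eta * (s ^+ 2 + k))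
      ('D_v f (u + t *: v) + eta * (2 * t)).
    apply: is_deriveD; first exact: is_derive_line.
    by apply: is_derive_eq; rewrite ?addr0 /GRing.scale /= ?expr1 ?mulr1; ring.
  have d2 (t : R) : is_derive t 1 (fun s => 'D_v f (u + s *: v) + eta * (2 * s))
      ('D_v (fun y => 'D_v f y) (u + t *: v) + eta * 2).
    apply: is_deriveD; first exact/is_derive_line/smooth_derive.
    by apply: is_derive_eq; rewrite /GRing.scale /=; ring.
  apply: (second_derivative_le0 d1 d2 _ rr rmax).
  have cl : continuous (fun t : R => u + t *: v).
    by move=> t; apply: cvgD; [exact: cvg_cst|apply: cvgZr_tmp; exact: cvg_id].
  apply: cvgD; last exact: cvg_cst.
  apply: (@continuous_comp _ _ _ _ (fun z => 'D_v (fun y => 'D_v f y) z) r (cl r)).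
  by apply: smooth_continuous; do 2 apply: smooth_derive.
have t1 : 'D_e1 (fun y => 'D_e1 f y) (a *: e1 + b *: e2) + eta * 2 <= 0.
  have -> : a *: e1 + b *: e2 = b *: e2 + a *: e1 by exact: addrC.
  apply: (test _ _ _ (b ^+ 2)) => // t tr.
  have := gmax (t, b); rewrite /g /= !(addrC (b *: e2)); apply.
  by apply/mem_set; split; rewrite /= in_itv /=; lra.
have t2 : 'D_e2 (fun y => 'D_e2 f y) (a *: e1 + b *: e2) + eta * 2 <= 0.
  apply: (test _ _ _ (a ^+ 2)) => // t tr.
  have := gmax (a, t); rewrite /g /= !(addrC (_ ^+ 2) (a ^+ 2)); apply.
  by apply/mem_set; split; rewrite /= in_itv /=; lra.
move: t1 t2 (lap (a *: e1 + b *: e2)) eta0.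
by move: ('D_e1 _ _) ('D_e2 _ _) => x y; clear; lra.
Qed.

End MaximumPrinciple.
(** * The form and null vectors *)

Section Pform.
Context {R : realType} {m : nat}.
Implicit Types (p : nat) (u v w : 'cV[R]_m) (a : R).

Lemma pformE p u v :
  pform p u v = \sum_(i < m) (if (i < p)%N then -1 else 1) * (u i 0 * v i 0).
Proof. by apply: eq_bigr => i _; case: ifP => _; rewrite ?mulN1r ?mul1r. Qed.

Lemma pformC p u v : pform p u v = pform p v u.
Proof. by rewrite !pformE; apply: eq_bigr => i _; rewrite (mulrC (u i 0)). Qed.

Lemma pformDl p u v w : pform p (u + v) w = pform p u w + pform p v w.
Proof.
by rewrite !pformE -big_split; apply: eq_bigr => i _; rewrite mxE mulrDl mulrDr.
Qed.

Lemma pformZl p a u v : pform p (a *: u) v = a * pform p u v.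
Proof. by rewrite !pformE mulr_sumr; apply: eq_bigr => i _; rewrite mxE; ring. Qed.

Lemma pformDr p u v w : pform p w (u + v) = pform p w u + pform p w v.
Proof. by rewrite !(pformC p w) pformDl. Qed.

Lemma pformZr p a u v : pform p u (a *: v) = a * pform p u v.
Proof. by rewrite !(pformC p u) pformZl. Qed.

Lemma pformNl p u v : pform p (- u) v = - pform p u v.
Proof. by rewrite -scaleN1r pformZl mulN1r. Qed.

Lemma pformNr p u v : pform p v (- u) = - pform p v u.
Proof. by rewrite !(pformC p v) pformNl. Qed.

Lemma pformBl p u v w : pform p (u - v) w = pform p u w - pform p v w.
Proof. by rewrite pformDl pformNl. Qed.

Lemma pformBr p u v w : pform p w (u - v) = pform p w u - pform p w v.
Proof. by rewrite pformDr pformNr. Qed.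

Lemma pform0l p u : pform p 0 u = 0.
Proof. by rewrite -(scale0r 0) pformZl mul0r. Qed.

Definition pform_linear :=
  (pformDl, pformDr, pformZl, pformZr, pformNl, pformNr).

Lemma pform_eq0 p u : (forall v, pform p u v = 0) -> u = 0.
Proof.
move=> u0; apply/colP => i; have := u0 (delta_mx i 0).
rewrite pformE (bigD1 i) //= big1 => [|j ji]; last first.
  by rewrite mxE (negbTE ji) !mulr0.
rewrite !mxE !eqxx mulr1 addr0 => /eqP; rewrite mulf_eq0 => /orP[|/eqP //].
by case: ifP; rewrite ?oppr_eq0 oner_eq0.
Qed.

End Pform.

Section PformCalculus.
Context {R : realType} {V : normedModType R} {m p : nat}.
Implicit Types f g : V -> 'cV[R]_m.+1.

Lemma smooth_pform f g : smooth setT f -> smooth setT g ->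
  smooth setT (fun u => pform p (f u) (g u)).
Proof.
move=> sf sg.
rewrite (_ : (fun u => _) = fun u =>
    \sum_(i < m.+1) (if (i < p)%N then -1 else 1) * (f u i 0 * g u i 0)).
  apply: smooth_sum => i; apply: smoothM; first exact: smooth_cst.
  by apply: smoothM; exact: smooth_coord.
by apply/funext => u; rewrite pformE.
Qed.

Lemma derive_pform f g u v : smooth setT f -> smooth setT g ->
  'D_v (fun u => pform p (f u) (g u)) u =
  pform p ('D_v f u) (g u) + pform p (f u) ('D_v g u).
Proof.
move=> sf sg; pose s (i : 'I_m.+1) : R := if (i < p)%N then -1 else 1.
have -> : (fun u => pform p (f u) (g u)) =
    \sum_i (fun u => s i * (f u i 0 * g u i 0)).
  by apply/funext => x; rewrite pformE fct_sumE.
have dh i : is_derive u v (fun u => s i * (f u i 0 * g u i 0))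
    (s i * ('D_v f u i 0 * g u i 0 + f u i 0 * 'D_v g u i 0)).
  rewrite !derive_coord //.
  have df : is_derive u v (fun u => f u i 0) ('D_v (fun u => f u i 0) u).
    by apply: derivableP; apply: smooth_derivable; exact: smooth_coord.
  have dg : is_derive u v (fun u => g u i 0) ('D_v (fun u => g u i 0) u).
    by apply: derivableP; apply: smooth_derivable; exact: smooth_coord.
  apply: is_derive_eq (is_deriveZ (s i) (is_deriveM df dg)) _.
  by rewrite /GRing.scale /= addrC (mulrC (g u i 0)).
apply: etrans (@derive_val _ _ _ _ _ _ _ (is_derive_sum dh)) _.
by rewrite !pformE -big_split; apply: eq_bigr => i _; rewrite mulrDr.
Qed.

End PformCalculus.

Lemma linear_inj_surj {R : realType} {n : nat}
    (L : {linear 'cV[R]_n.+1 -> 'cV[R]_n.+1}) : injective L ->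
  forall v, exists u, v = L u.
Proof.
move=> Linj v; have kL : lker (linfun L) == 0%VS.
  by apply/lker0P => x y; rewrite !lfunE; exact: Linj.
by exists ((linfun L)^-1%VF v); have := lker0_lfunVK kL v; rewrite lfunE.
Qed.

Section Minkowski.
Context {R : realType} {n : nat}.
Local Notation V := 'cV[R]_n.+1.
Local Notation mink := (@pform R 1 n.+1).
Implicit Types u v w l e : V.

Definition lightlike l := mink l l = 0 /\ 0 < l ord0 0.

Lemma minkE u v : mink u v =
  - (u ord0 0 * v ord0 0) + \sum_(i < n) u (lift ord0 i) 0 * v (lift ord0 i) 0.
Proof. by rewrite /pform big_ord_recl. Qed.

Lemma mink_space w : w ord0 0 = 0 -> 0 <= mink w w /\ (mink w w = 0 -> w = 0).
Proof.
move=> w0; rewrite minkE w0 mul0r oppr0 add0r.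
have sq i : 0 <= w (lift ord0 i) 0 * w (lift ord0 i) 0 by rewrite -expr2 sqr_ge0.
split; first by apply: sumr_ge0 => i _; exact: sq.
move=> /eqP; rewrite psumr_eq0 => [/allP wi|i _]; last exact: sq.
apply/colP => i; rewrite mxE; case: (unliftP ord0 i) => [j ->|-> //].
by have := wi j (mem_index_enum _); rewrite /= mulf_eq0 orbb => /eqP.
Qed.

(** Subtracting from [w] the multiple of [l] that kills its time component leaves a
    spatial vector, whose square is nonnegative; all the causality facts below are
    read off this inequality and its equality case. *)
Lemma lightlike_ineq l w : lightlike l ->
  2 * w ord0 0 * mink w l <= l ord0 0 * mink w w /\
  (2 * w ord0 0 * mink w l = l ord0 0 * mink w w ->
   w = (w ord0 0 / l ord0 0) *: l).
Proof.
move=> [l0 lp]; set a := w ord0 0; set b := l ord0 0.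
have b0 : b != 0 by rewrite gt_eqF.
pose z := w - (a / b) *: l.
have z0 : z ord0 0 = 0 by rewrite !mxE /a /b divfK // subrr.
have E : b * mink z z = b * mink w w - 2 * a * mink w l.
  by rewrite /z !pform_linear l0 (pformC 1 l w); field.
have [zge zeq] := mink_space z0; split.
  by rewrite -subr_ge0 -E mulr_ge0 // ltW.
move=> /esym/eqP; rewrite -subr_eq0 -E mulf_eq0 (negbTE b0) => /eqP/zeq/eqP.
by rewrite subr_eq0 => /eqP.
Qed.

Lemma lightlike_orth_ge0 l w : lightlike l -> mink w l = 0 -> 0 <= mink w w.
Proof.
move=> ll wl; have [+ _] := lightlike_ineq w ll.
by rewrite wl mulr0 pmulr_rge0 //; case: ll.
Qed.

Lemma lightlike_orth_eq l w : lightlike l -> mink w l = 0 -> mink w w = 0 ->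
  w = (w ord0 0 / l ord0 0) *: l.
Proof.
by move=> ll wl ww; have [_] := lightlike_ineq w ll; apply; rewrite wl ww !mulr0.
Qed.

Lemma causal_lightlike_le0 l w : lightlike l -> mink w w <= 0 -> 0 < w ord0 0 ->
  mink w l <= 0.
Proof.
move=> ll ww w0; have [+ _] := lightlike_ineq w ll.
have : l ord0 0 * mink w w <= 0 by rewrite pmulr_rle0 //; case: ll.
move=> h1 h2; have := le_trans h2 h1; rewrite -mulrA pmulr_rle0 //.
by rewrite pmulr_rle0.
Qed.

Lemma timelike_lightlike_lt0 l w : lightlike l -> mink w w < 0 -> 0 < w ord0 0 ->
  mink w l < 0.
Proof.
move=> ll ww w0; have [+ _] := lightlike_ineq w ll.
have : l ord0 0 * mink w w < 0 by rewrite pmulr_rlt0 //; case: ll.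
move=> h1 h2; have := le_lt_trans h2 h1; rewrite -mulrA pmulr_rlt0 //.
by rewrite pmulr_rlt0.
Qed.

Lemma future_of_lightlike l w : lightlike l -> mink w w <= 0 -> mink w l < 0 ->
  0 < w ord0 0.
Proof.
move=> ll ww wl; have [+ _] := lightlike_ineq w ll.
have : l ord0 0 * mink w w <= 0 by rewrite pmulr_rle0 //; case: ll.
move=> h1 h2; have := le_trans h2 h1.
rewrite -mulrA pmulr_rle0 // nmulr_lle0 // le0r => /orP[/eqP w0|//].
have [wge weq] := mink_space w0.
have w00 : w = 0 by apply: weq; apply/eqP; rewrite eq_le ww.
by move: wl; rewrite w00 pform0l ltxx.
Qed.

Lemma lightlike_mink_le0 l1 l2 : lightlike l1 -> lightlike l2 -> mink l1 l2 <= 0.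
Proof. by move=> [l10 l1p] ll2; apply: causal_lightlike_le0; rewrite // l10. Qed.

Lemma lightlikeZ (a : R) l : 0 < a -> lightlike l -> lightlike (a *: l).
Proof.
move=> a0 [l0 lp]; split; first by rewrite !pform_linear l0 !mulr0.
by rewrite mxE mulr_gt0.
Qed.

(** Three linear conditions on a space of dimension n + 1 >= 4; this is where
    [3 <= n] enters. *)
Lemma exists_orthogonal3 a b c : (3 <= n)%N ->
  exists2 w, w != 0 & [/\ mink w a = 0, mink w b = 0 & mink w c = 0].
Proof.
move=> n3; pose s (i : 'I_n.+1) : R := if (i < 1)%N then -1 else 1.
pose t (j : 'I_3) : V := nth 0 [:: a; b; c] j.
pose B := \matrix_(i < n.+1, j < 3) (s i * t j i 0).
have kB : kermx B != 0.
  rewrite -mxrank_eq0 mxrank_ker subn_eq0 -ltnNge.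
  by apply: leq_ltn_trans (rank_leq_col B) _.
have [v vB v0] := rowV0Pn kB.
have tB j : mink v^T (t j) = 0.
  have /sub_kermxP/rowP/(_ j) := vB; rewrite !mxE => E.
  rewrite pformE -[RHS]E.
  by apply: eq_bigr => i _; rewrite !mxE mulrCA.
exists v^T; first by rewrite trmx_eq0.
by split; [exact: (tB ord0)|exact: (tB (lift ord0 ord0))|exact: (tB ord_max)].
Qed.

End Minkowski.

Section NullPair.
Context {R : realType} {n : nat}.
Local Notation V := 'cV[R]_n.+1.
Local Notation mink := (@pform R 1 n.+1).
Variables e e' : V.
Hypotheses (le : lightlike e) (le' : lightlike e') (ee' : mink e e' = -1).

(** Projection along [e] and [e'] onto the spacelike subspace orthogonal to both.
    Working with it lets the whole ambient space serve as parameter space of the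
    horospheres. *)
Definition screen (v : V) : V := v + mink v e' *: e + mink v e *: e'.
Local Notation P := screen.

Let e'e : mink e' e = -1. Proof. by rewrite pformC. Qed.
Let ee : mink e e = 0. Proof. by case: le. Qed.
Let e'e' : mink e' e' = 0. Proof. by case: le'. Qed.

Lemma screen_orthl v : mink (P v) e = 0.
Proof. by rewrite /screen !pform_linear ee e'e; ring. Qed.

Lemma screen_orthr v : mink (P v) e' = 0.
Proof. by rewrite /screen !pform_linear e'e' ee'; ring. Qed.

Lemma screen_id v : mink v e = 0 -> mink v e' = 0 -> P v = v.
Proof. by move=> ve ve'; rewrite /screen ve ve' !scale0r !addr0. Qed.

Lemma screenD u v : P (u + v) = P u + P v.
Proof. by rewrite /screen !pformDl !scalerDl; apply/colP => i; rewrite !mxE; ring. Qed.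

Lemma screenZ (a : R) v : P (a *: v) = a *: P v.
Proof. by rewrite /screen !pformZl; apply/colP => i; rewrite !mxE; ring. Qed.

Lemma orth_pair_ge0 w : mink w e = 0 -> mink w e' = 0 ->
  0 <= mink w w /\ (mink w w = 0 -> w = 0).
Proof.
move=> we we'; split; first exact: lightlike_orth_ge0 we.
move=> ww; have E := lightlike_orth_eq le we ww.
move: we'; rewrite E pformZl ee' => /eqP.
by rewrite mulf_eq0 oppr_eq0 oner_eq0 orbF => /eqP ->; rewrite scale0r.
Qed.

Lemma screen_frame : (3 <= n)%N -> exists e1 e2 : V,
  [/\ P e1 = e1, P e2 = e2, mink e1 e1 = 1, mink e2 e2 = 1 & mink e1 e2 = 0].
Proof.
move=> n3; have unit w : w != 0 -> mink w e = 0 -> mink w e' = 0 ->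
    mink ((Num.sqrt (mink w w))^-1 *: w) ((Num.sqrt (mink w w))^-1 *: w) = 1.
  move=> w0 we we'; have [wge weq] := orth_pair_ge0 we we'.
  have ww : mink w w != 0 by apply: contra_neq w0.
  by rewrite pformZl pformZr mulrA -expr2 exprVn sqr_sqrtr // mulVf.
have [a a0 [ae ae' _]] := exists_orthogonal3 e e' e n3.
have [b b0 [be be' ba]] := exists_orthogonal3 e e' a n3.
exists ((Num.sqrt (mink a a))^-1 *: a), ((Num.sqrt (mink b b))^-1 *: b).
split; rewrite ?unit // ?screenZ ?screen_id //.
by rewrite pformZl pformZr (pformC 1 a) ba !mulr0.
Qed.

(** The image of [A], together with [l], spans a hyperplane contained in the
    orthogonal of [l]. If [y] were spacelike it would be independent of that
    hyperplane, so the orthogonal of [l] would be everything, against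
    nondegeneracy. *)
Lemma normal_plane_orth_null (A : {linear V -> V}) (l y : V) :
    lightlike l -> (forall v w, mink (A v) (A w) = mink (P v) (P w)) ->
    (forall v, mink (A v) l = 0) -> mink y l = 0 -> (forall v, mink y (A v) = 0) ->
  mink y y = 0.
Proof.
move=> ll AA Al yl yA; apply/eqP/negPn/negP => yy.
(* M sends e' to -l, e to -y and agrees with A on the screen: an injective
   endomorphism with image in the orthogonal of l. *)
pose M v := A (P v) + (mink v e *: l + mink v e' *: y).
have linM : linear M.
  move=> a u v; rewrite /M screenD screenZ linearP !pformDl !pformZl.
  by apply/colP => i; rewrite !mxE; ring.
pose lM := GRing.isLinear.Build _ _ _ _ _ linM.
pose L : {linear V -> V} := HB.pack M lM.
have Ml v : mink (M v) l = 0.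
  by rewrite /M !pform_linear Al yl (proj1 ll) !mulr0 !addr0.
have Minj v : M v = 0 -> v = 0.
  move=> Mv.
  have PPv : P (P v) = P v by apply: screen_id; [exact: screen_orthl|exact: screen_orthr].
  have E : mink (M v) (M v) = mink (P v) (P v) + mink v e' ^+ 2 * mink y y.
    rewrite /M; have := AA (P v) (P v); rewrite PPv; move: (P v) => w ww.
    rewrite !pform_linear ww (pformC 1 l (A _)) (pformC 1 (A _) y).
    by rewrite (pformC 1 l y) !Al !yA !yl (proj1 ll); ring.
  have [Pge Peq] := orth_pair_ge0 (screen_orthl v) (screen_orthr v).
  have yge := lightlike_orth_ge0 ll yl.
  move: E; rewrite Mv pform0l => /esym/eqP.
  rewrite paddr_eq0 //; last by rewrite mulr_ge0 // sqr_ge0.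
  rewrite mulf_eq0 (negbTE yy) orbF sqrf_eq0 => /andP[/eqP/Peq Pv /eqP ve'].
  have ve : mink v e = 0.
    move: Mv; rewrite /M Pv linear0 add0r ve' scale0r addr0 => /eqP.
    rewrite scaler_eq0 => /orP[/eqP //|/eqP l0].
    by have := proj2 ll; rewrite l0 mxE ltxx.
  by move: Pv; rewrite screen_id.
have Linj : injective L.
  move=> u v uv; apply/eqP; rewrite -subr_eq0; apply/eqP/Minj.
  by have -> : M (u - v) = L u - L v := linearB L u v; rewrite uv subrr.
have l0 : l = 0.
  apply: (@pform_eq0 _ _ 1) => v; have [u ->] := linear_inj_surj Linj v.
  by rewrite pformC; exact: Ml.
by have := proj2 ll; rewrite l0 mxE ltxx.
Qed.

End NullPair.
(** * Horospheres: flat sections of the null cone *)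

Section DerivativeRules.
Context {R : realType} {V : normedModType R} {m : nat}.

Lemma derive_scale (a : V -> R) (f : V -> 'cV[R]_m.+1) u v :
  smooth setT a -> smooth setT f ->
  'D_v (fun x => a x *: f x) u = 'D_v a u *: f u + a u *: 'D_v f u.
Proof.
move=> sa sf; apply/colP => i; rewrite derive_coord; last exact: smoothZ.
rewrite !mxE derive_coord //.
have -> : (fun x => (a x *: f x) i 0) = a * (fun x => f x i 0).
  by apply/funext => x; rewrite mxE.
rewrite deriveM; [|exact: smooth_derivable|].
  by rewrite addrC /GRing.scale /= (mulrC (f u i 0)).
by apply: smooth_derivable; exact: smooth_coord.
Qed.

Lemma derive_add (f g : V -> 'cV[R]_m.+1) u v :
  smooth setT f -> smooth setT g ->
  'D_v (fun x => f x + g x) u = 'D_v f u + 'D_v g u.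
Proof. by move=> sf sg; rewrite -deriveD //; exact: smooth_derivable. Qed.

Lemma derive_const (W : normedModType R) (a : W) (u v : V) : 'D_v (fun=> a) u = 0.
Proof. exact: derive_cst. Qed.

End DerivativeRules.

Section Horosphere.
Context {R : realType} {n : nat}.
Local Notation V := 'cV[R]_n.+1.
Local Notation mink := (@pform R 1 n.+1).
Variables e e' : V.
Hypotheses (le : lightlike e) (le' : lightlike e') (ee' : mink e e' = -1).
Local Notation P := (screen e e').

Let e'e : mink e' e = -1. Proof. by rewrite pformC. Qed.
Let ee : mink e e = 0. Proof. by case: le. Qed.
Let e'e' : mink e' e' = 0. Proof. by case: le'. Qed.

Definition horosphere (u : V) : V := e + P u + (mink (P u) (P u) / 2) *: e'.

Lemma horosphere0 : horosphere 0 = e.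
Proof.
by rewrite /horosphere screen_id ?pform0l // mul0r scale0r !addr0.
Qed.

Lemma horosphere_lightlike u : lightlike (horosphere u).
Proof.
have Pe := screen_orthl le ee' u; have Pe' := screen_orthr le' ee' u.
have null : mink (horosphere u) (horosphere u) = 0.
  rewrite /horosphere; move: (P u) Pe Pe' => w we we'.
  rewrite !pform_linear ee ee' e'e e'e' we we' (pformC 1 e w) (pformC 1 e' w) we we'.
  by field.
split=> //; apply: (future_of_lightlike le'); first by rewrite null.
rewrite /horosphere; move: (P u) Pe' => w we'.
by rewrite !pform_linear ee' e'e' we' addr0 mulr0 addr0 oppr_lt0.
Qed.

Lemma smooth_screen : smooth setT P.
Proof.
have sid := @smooth_id R V.
apply: smoothD; first apply: smoothD => //; apply: smoothZ.
- by apply: smooth_pform => //; exact: smooth_cst.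
- exact: smooth_cst.
- by apply: smooth_pform => //; exact: smooth_cst.
- exact: smooth_cst.
Qed.

Lemma smooth_horosphere : smooth setT horosphere.
Proof.
have sP := smooth_screen.
apply: smoothD; first by apply: smoothD => //; exact: smooth_cst.
apply: smoothZ; last exact: smooth_cst.
by apply: smoothM; [exact: smooth_pform|exact: smooth_cst].
Qed.

Lemma derive_screen u v : 'D_v P u = P v.
Proof.
rewrite deriveE; last exact: smooth_differentiable smooth_screen.
have lP : linear P by move=> a x y; rewrite screenD screenZ.
pose lM := GRing.isLinear.Build _ _ _ _ _ lP.
pose L : {linear V -> V} := HB.pack P lM.
have -> : P = L by [].
by rewrite diff_lin //; exact: smooth_continuous smooth_screen.
Qed.

Lemma derive_horosphere u v :
  'D_v horosphere u = P v + mink (P u) (P v) *: e'.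
Proof.
have sP := smooth_screen.
have sc : smooth (setT : set V) (fun=> e) by exact: smooth_cst.
have sc' : smooth (setT : set V) (fun=> e') by exact: smooth_cst.
have sq : smooth setT (fun u => mink (P u) (P u)) by exact: smooth_pform.
have sq2 : smooth setT (fun u => mink (P u) (P u) / 2).
  by apply: smoothM => //; exact: smooth_cst.
rewrite derive_add; [|exact: smoothD|exact: smoothZ].
rewrite derive_add // derive_scale // !derive_const scaler0 addr0 add0r derive_screen.
congr (_ + _ *: _).
have -> : (fun u => mink (P u) (P u) / 2) = (fun u => mink (P u) (P u)) * cst (2^-1) by [].
rewrite deriveMr; last exact: smooth_derivable.
rewrite derive_pform // derive_screen (pformC 1 (P v)) /GRing.scale /=.
by field.
Qed.

Lemma horosphere_flat u v w :
  mink ('D_v horosphere u) ('D_w horosphere u) = mink (P v) (P w).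
Proof.
rewrite !derive_horosphere; have Pv := screen_orthr le' ee' v.
have Pw := screen_orthr le' ee' w.
move: (mink (P u) (P v)) (mink (P u) (P w)) => a b; move: (P v) (P w) Pv Pw => x y xe ye.
by rewrite !pform_linear e'e' xe (pformC 1 e' y) ye; ring.
Qed.

End Horosphere.

Section Exchange.
Context {R : realType} {n : nat}.
Local Notation V := 'cV[R]_n.+1.
Local Notation mink := (@pform R 1 n.+1).

(** Up to scale, the inversion of the screen exchanges the horospheres based at the
    two ends of the null pair: it carries a neighbourhood of infinity on one to a
    neighbourhood of the base point of the other. *)
Lemma horosphere_inversion (e e' u : V) : screen e e' u = u -> mink u u != 0 ->
  horosphere e e' u = (mink u u / 2) *: horosphere e' e ((2 / mink u u) *: u).
Proof.
move=> Pu u0; set q := mink u u in u0 *.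
have Qu : screen e' e ((2 / q) *: u) = (2 / q) *: u.
  rewrite -{2}Pu /screen !pformZl; apply/colP => i; rewrite !mxE; ring.
rewrite /horosphere Pu Qu pformZl pformZr -/q.
by apply/colP => i; rewrite !mxE; field.
Qed.

Lemma exists_null_partner (e : V) : lightlike e ->
  exists2 e', lightlike e' & mink e e' = -1.
Proof.
move=> [e0 ep]; set b := e ord0 0 in ep.
have dd : mink (delta_mx ord0 0) (delta_mx ord0 0) = -1.
  rewrite minkE big1 => [|i _]; first by rewrite !mxE /=; ring.
  by rewrite !mxE /= mul0r.
have de : mink e (delta_mx ord0 0) = - b.
  rewrite minkE big1 => [|i _]; first by rewrite !mxE /= /b; ring.
  by rewrite !mxE /= mulr0.
(* The reflection of e in the time axis, rescaled. *)
exists ((2 * b ^+ 2)^-1 *: ((2 * b) *: delta_mx ord0 0 - e)).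
  apply: lightlikeZ; first by rewrite invr_gt0 mulr_gt0 // exprn_gt0.
  split; first by rewrite !pform_linear e0 dd (pformC 1 _ e) de; ring.
  by rewrite !mxE /= -/b; lra.
rewrite pformZr !pform_linear e0 de; field; by rewrite gt_eqF.
Qed.

End Exchange.

(** * Isometries of the null cone are homogeneous *)

Section PlotIsometry.
Context {R : realType}.

(** Isometries tested on all smooth families of points of [S] instead of on curves.
    This form composes trivially and allows several parameters at once, which the
    differentiations along horospheres need. *)
Definition plot_isometry (p m : nat) (S : set 'cV[R]_m.+1)
    (f : 'cV[R]_m.+1 -> 'cV[R]_m.+1) : Prop :=
  (forall x, S x -> S (f x)) /\
  forall (V0 : normedModType R) (psi : V0 -> 'cV[R]_m.+1),
    smooth setT psi -> (forall u, S (psi u)) ->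
    smooth setT (fun u => f (psi u)) /\
    forall u v w, pform p ('D_v (fun u => f (psi u)) u) ('D_w (fun u => f (psi u)) u) =
                  pform p ('D_v psi u) ('D_w psi u).

End PlotIsometry.

Section ConeIsometry.
Context {R : realType} {n : nat}.
Local Notation V := 'cV[R]_n.+1.
Local Notation mink := (@pform R 1 n.+1).
Variable f : V -> V.
Hypothesis n3 : (3 <= n)%N.
Hypothesis isof : plot_isometry 1 (@lightlike R n) f.

Let fL x : lightlike x -> lightlike (f x). Proof. by case: isof => h _; exact: h. Qed.

Lemma plot_orth (V0 : normedModType R) (g : V0 -> V) u v : smooth setT g ->
  (forall u, lightlike (g u)) -> mink ('D_v g u) (g u) = 0.
Proof.
move=> sg lg; have := derive_pform (p := 1) u v sg sg.
have -> : (fun u => mink (g u) (g u)) = fun=> 0.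
  by apply/funext => x; case: (lg x).
rewrite derive_const (pformC 1 (g u)) => /esym/eqP.
by rewrite -mulr2n mulrn_eq0 => /eqP.
Qed.

(** The image [r] of the ray has null velocity orthogonal to the null vector [r], so
    [r'] is a multiple of [r] and the ratios of coordinates of [r] are constant. *)
Lemma ray_parallel x (c : R) : lightlike x -> 1 <= c ->
  f (c *: x) = (f (c *: x) ord0 0 / f x ord0 0) *: f x.
Proof.
move=> lx c1.
(* A polynomial parametrization that stays on the positive ray for all real t. *)
pose a : R -> R := fun t => 1 + t * t.
have a0 t : 0 < a t by rewrite /a ltr_wpDr // -expr2 sqr_ge0.
have sa : smooth (setT : set R^o) (a : R^o -> R).
  apply: smoothD; first exact: smooth_cst.
  by apply: smoothM; exact: (@smooth_id R R^o).
have scx : smooth (setT : set R^o) (fun=> x) by exact: smooth_cst.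
pose psi : R^o -> V := fun t => a t *: x.
have spsi : smooth setT psi by exact: smoothZ.
have lpsi t : lightlike (psi t) by exact: lightlikeZ.
have [sr isor] := (proj2 isof) _ psi spsi lpsi.
set r := (fun u => f (psi u)) in sr isor.
have lr t : lightlike (r t) by exact: fL.
have Dr t : 'D_1 r t = ('D_1 r t ord0 0 / r t ord0 0) *: r t.
  apply: lightlike_orth_eq => //; first exact: plot_orth.
  rewrite isor derive_scale // derive_const scaler0 addr0 pformZl pformZr.
  by rewrite (proj1 lx) !mulr0.
have r0 t : r t ord0 0 != 0 by rewrite gt_eqF //; case: (lr t).
have q_cst i (s t : R) : r s i 0 / r s ord0 0 = r t i 0 / r t ord0 0.
  apply: (@derive0_cst _ (fun t : R => r t i 0 / r t ord0 0)) => {}t.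
  have dri j : is_derive (t : R) (1 : R) (fun t : R => r t j 0) ('D_1 r t j 0).
    rewrite derive_coord //; apply: derivableP.
    by apply: smooth_derivable; exact: smooth_coord.
  apply: is_derive_eq (is_deriveM (dri i) (is_deriveV (r0 t) (dri ord0))) _.
  have /colP/(_ i) := Dr t; rewrite mxE => ->; rewrite /GRing.scale /=.
  by field.
have [t ct] : exists t, c = a t.
  exists (Num.sqrt (c - 1)); rewrite /a -expr2 sqr_sqrtr ?subr_ge0 //.
  by rewrite addrC subrK.
have a00 : a 0 = 1 by rewrite /a mulr0 addr0.
have E0 : f x = r 0 by rewrite /r /psi a00 scale1r.
have Et : f (c *: x) = r t by rewrite /r /psi ct.
rewrite E0 Et; apply/colP => i; rewrite !mxE.
by have := q_cst i t 0 => /(canRL (divfK (r0 t))) ->; field.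
Qed.

(** Both F(u) = f(c psi(u)) and G(u) = f(psi(u)) lie on the same ray, say F = m G.
    For a unit direction of the horosphere the derivative of F has norm c and, up
    to a multiple of the null vector G, it is m times that of G, whose norm is 1;
    so m = c. To avoid differentiating the quotient m, the relation is written as
    F_0 G = G_0 F with the time components as weights. *)
Lemma homogeneous_ge1 x (c : R) : lightlike x -> 1 <= c -> f (c *: x) = c *: f x.
Proof.
move=> lx c1; have c0 : 0 < c by exact: lt_le_trans c1.
have [e' le' ee'] := exists_null_partner lx.
have [e1 [_ [Pe1 _ e11 _ _]]] := screen_frame lx ee' n3.
pose psi := horosphere x e'.
have spsi : smooth setT psi by exact: smooth_horosphere.
have lpsi u : lightlike (psi u) by exact: horosphere_lightlike.
have scst : smooth (setT : set V) (fun=> c) by exact: smooth_cst.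
have scpsi : smooth setT (fun u => c *: psi u) by exact: smoothZ.
have lcpsi u : lightlike (c *: psi u) by exact: lightlikeZ.
have [sG isoG] := (proj2 isof) _ psi spsi lpsi.
have [sF isoF] := (proj2 isof) _ _ scpsi lcpsi.
set G := (fun u => f (psi u)) in sG isoG.
set F := (fun u => f (c *: psi u)) in sF isoF.
have psi0 : psi 0 = x by exact: horosphere0.
suff E : F 0 ord0 0 = c * G 0 ord0 0.
  rewrite (ray_parallel lx c1); move: E; rewrite /F /G psi0 => ->.
  by rewrite mulfK // gt_eqF //; case: (fL lx).
have lF u : lightlike (F u) by exact: fL.
have lG u : lightlike (G u) by exact: fL.
have FG u : F u ord0 0 *: G u = G u ord0 0 *: F u.
  rewrite /F [X in _ = _ *: X](ray_parallel (lpsi u) c1) scalerA -/(G u) -/(F u).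
  by rewrite mulrC divfK // gt_eqF //; case: (lG u).
have NG : mink ('D_e1 G 0) ('D_e1 G 0) = 1.
  by rewrite isoG horosphere_flat // Pe1.
have NF : mink ('D_e1 F 0) ('D_e1 F 0) = c ^+ 2.
  rewrite isoF derive_scale // derive_const scale0r add0r pformZl pformZr.
  by rewrite horosphere_flat // Pe1 e11 mulr1 expr2.
have DFG : 'D_e1 (fun u => F u ord0 0 *: G u) 0 = 'D_e1 (fun u => G u ord0 0 *: F u) 0.
  by congr ('D_e1 _ 0); apply/funext.
have sF0 : smooth setT (fun u => F u ord0 0) by exact: smooth_coord.
have sG0 : smooth setT (fun u => G u ord0 0) by exact: smooth_coord.
have := etrans (esym (derive_scale 0 e1 sF0 sG)) (etrans DFG (derive_scale 0 e1 sG0 sF)).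
have oG := plot_orth 0 e1 sG lG; have oF := plot_orth 0 e1 sF lF.
have := FG 0; have [G0 Gp] := lG 0; have [F0 Fp] := lF 0.
move: NG NF oG oF; move: ('D_e1 G 0) ('D_e1 F 0) ('D_e1 (fun u => F u ord0 0) 0)
  ('D_e1 (fun u => G u ord0 0) 0).
move: (F 0) (G 0) F0 Fp G0 Gp => X Y XX X0 YY Y0 y x' a b yy xx yY xX XY.
set s := X ord0 0 in X0 XY *; set t := Y ord0 0 in Y0 XY *.
have sn : s != 0 by rewrite gt_eqF.
have tn : t != 0 by rewrite gt_eqF.
have YE : Y = (t / s) *: X.
  by rewrite (mulrC t) -scalerA -XY scalerA mulVf // scale1r.
move=> E; have xY : mink x' Y = 0 by rewrite YE pformZr xX mulr0.
have bX : b *: X = (b * s / t) *: Y.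
  have -> : b *: X = (b * s / t * (t / s)) *: X.
    by congr (_ *: _); field; rewrite sn.
  by rewrite -scalerA -YE.
have {}E : s *: y = t *: x' + (b * s / t - a) *: Y.
  by rewrite scalerBl -bX addrA [t *: x' + _]addrC -E addrAC subrr add0r.
have : mink (s *: y) (s *: y) = (s) ^+ 2 by rewrite pformZl pformZr yy; ring.
rewrite E !pform_linear xx xY (pformC 1 Y) xY YY !mulr0 !addr0 => E2.
have : (c * t) ^+ 2 = s ^+ 2 by rewrite -E2; ring.
by move/eqP; rewrite eqrXn2 // ?ltW ?mulr_gt0 // => /eqP.
Qed.

Lemma homogeneous x (c : R) : lightlike x -> 0 < c -> f (c *: x) = c *: f x.
Proof.
move=> lx c0; case: (leP 1 c) => [|c1]; first exact: homogeneous_ge1.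
have cn : c != 0 by rewrite gt_eqF.
have lcx : lightlike (c *: x) by exact: lightlikeZ.
have ci : 1 <= c^-1 by rewrite invf_ge1 // ltW.
have := homogeneous_ge1 lcx ci; rewrite scalerA mulVf // scale1r => ->.
by rewrite scalerA mulfV // scale1r.
Qed.

End ConeIsometry.
(** * Flat images and the inequality between products *)

Section FirstOrder.
Context {R : realType} {m : nat}.
Local Notation V := 'cV[R]_m.+1.

Lemma coord_le_norm (x : V) i : `|x i 0| <= `|x|.
Proof. by rewrite [leRHS]/Num.Def.normr/= mx_normrE; exact: (le_bigmax _ _ (i, 0)). Qed.

Lemma pform_le_norm p (x y : V) : `|pform p x y| <= m.+1%:R * (`|x| * `|y|).
Proof.
rewrite /pform; apply: le_trans (ler_norm_sum _ _ _) _.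
apply: (@le_trans _ _ (\sum_(i < m.+1) `|x| * `|y|)); last first.
  by rewrite sumr_const card_ord mulr_natl.
apply: ler_sum => i _; apply: (@le_trans _ _ (`|x i 0| * `|y i 0|)).
  by case: ifP; rewrite ?normrN normrM.
by apply: ler_pM => //; exact: coord_le_norm.
Qed.

(** First-order expansion of [f] at 0, squared with the indefinite form: the error is
    controlled by the Euclidean norm, uniformly in the direction of [s]. *)
Lemma pform_first_order p (f : V -> V) (e : R) : differentiable f 0 -> 0 < e ->
  exists2 d, 0 < d & forall s : V, `|s| < d ->
    pform p (f s - f 0) (f s - f 0) <=
    pform p ('d f 0 s) ('d f 0 s) + e * `|s| ^+ 2.
Proof.
move=> df e0; have [k k0 kP] := linear_lipschitz (diff_continuous df).
pose c : R := m.+1%:R; have c0 : 0 < c by rewrite ltr0n.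
pose eta := Num.min 1 (e / (c * (2 * k + 1))).
have k1 : 0 < 2 * k + 1 by lra.
have eta0 : 0 < eta by rewrite lt_min ltr01 divr_gt0 // mulr_gt0.
have eta1 : eta <= 1 by rewrite ge_min lexx.
have etae : c * (eta * (2 * k + 1)) <= e.
  have : eta <= e / (c * (2 * k + 1)) by rewrite ge_min lexx orbT.
  by rewrite ler_pdivlMr ?mulr_gt0 // => h; apply: le_trans h; rewrite mulrCA.
have /diff_locally/eqaddoE/eqaddoP/(_ _ eta0)/nbhs_ballP[d /= d0 Hd] := df.
exists d => // s sd; have sb : ball 0 d s.
  by rewrite -ball_normE /= sub0r normrN.
have kD : `|'d f 0 s| <= k * `|s| by exact: kP.
have -> : f s - f 0 = 'd f 0 s + (f s - f 0 - 'd f 0 s) by rewrite [RHS]addrC subrK.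
have : `|f s - f 0 - 'd f 0 s| <= eta * `|s|.
  by have := Hd s sb; rewrite /= !fctE /= addr0 opprD addrA.
move: kD; move: ('d f 0 s) (f s - f 0 - _) => D r kD rs.
have s0 : 0 <= `|s| by [].
have Dr : pform p D r <= c * (k * eta * `|s| ^+ 2).
  apply: le_trans (ler_norm _) _; apply: le_trans (pform_le_norm _ _ _) _.
  rewrite ler_pM2l //; apply: (@le_trans _ _ ((k * `|s|) * (eta * `|s|))).
    exact: ler_pM (normr_ge0 _) (normr_ge0 _) kD rs.
  by rewrite expr2 mulrACA.
have rr : pform p r r <= c * (eta * `|s| ^+ 2).
  apply: le_trans (ler_norm _) _; apply: le_trans (pform_le_norm _ _ _) _.
  rewrite ler_pM2l //; apply: (@le_trans _ _ ((eta * `|s|) * (eta * `|s|))).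
    by apply: ler_pM.
  rewrite expr2 mulrACA -!mulrA ler_pM2l // !mulrA; apply: ler_wpM2r => //.
  by apply: ler_piMl.
rewrite !(pformDl, pformDr) (pformC p r D) -!addrA lerD2l !addrA -mulr2n -mulr_natl.
apply: (@le_trans _ _ (c * (eta * (2 * k + 1)) * `|s| ^+ 2)); last first.
  by apply: ler_wpM2r etae; rewrite exprn_ge0.
move: Dr rr; move: (pform p D r) (pform p r r) => x y hx hy.
have -> : c * (eta * (2 * k + 1)) * `|s| ^+ 2 =
  2 * (c * (k * eta * `|s| ^+ 2)) + c * (eta * `|s| ^+ 2) by ring.
by apply: lerD => //; rewrite ler_pM2l.
Qed.

End FirstOrder.

Section NullLaplacian.
Context {R : realType} {n : nat}.
Local Notation V := 'cV[R]_n.+1.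
Local Notation mink := (@pform R 1 n.+1).

(** The linear algebra behind [laplacian_flat_image], with [D] the tangent map and
    [A], [B], [C] the second derivatives D_1 D_1 G, D_2 D_2 G, D_1 D_2 G at a point
    [g] of the flat submanifold. All three are normal to it; [C] and [A - B] are
    also orthogonal to [g], hence null, and the Gauss equation [mink A B = mink C C]
    then makes [A + B] null. *)
Lemma null_laplacian (g z A B C : V) (D : V -> V) :
    lightlike g -> lightlike z ->
    (forall y, mink y g = 0 -> (forall v, mink y (D v) = 0) -> mink y y = 0) ->
    mink A g = -1 -> mink B g = -1 -> mink C g = 0 ->
    (forall v, mink A (D v) = 0) -> (forall v, mink B (D v) = 0) ->
    (forall v, mink C (D v) = 0) -> mink A B = mink C C ->
  mink (A + B) z <= 0.
Proof.
move=> lg lz normal GA GB GC TA TB TC AB.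
have CC : mink C C = 0 by exact: normal.
have AmB : mink (A - B) (A - B) = 0.
  apply: normal; first by rewrite pformBl GA GB subrr.
  by move=> v; rewrite pformBl TA TB subrr.
have W0 : mink (A + B) (A + B) = 0.
  have -> : mink (A + B) (A + B) = mink (A - B) (A - B) + 4 * mink A B.
    by rewrite !pform_linear (pformC 1 B A); ring.
  by rewrite AmB AB CC mulr0 addr0.
have WG : mink (A + B) g = -2 by rewrite pformDl GA GB; ring.
apply: causal_lightlike_le0 => //; first by rewrite W0.
apply: (future_of_lightlike lg); first by rewrite W0.
by rewrite WG oppr_lt0.
Qed.

End NullLaplacian.

Section Contraction.
Context {R : realType} {n : nat}.
Local Notation V := 'cV[R]_n.+1.
Local Notation mink := (@pform R 1 n.+1).
Variable f : V -> V.
Hypothesis n3 : (3 <= n)%N.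
Hypothesis isof : plot_isometry 1 (@lightlike R n) f.

Section Screen.
Variables e e' : V.
Hypotheses (le : lightlike e) (le' : lightlike e') (ee' : mink e e' = -1).
Local Notation P := (screen e e').

Definition flat_image (u : V) : V := f (horosphere e e' u).
Local Notation G := flat_image.

Lemma smooth_flat_image : smooth setT G.
Proof.
by have [] := (proj2 isof) _ _ (smooth_horosphere e e') (horosphere_lightlike le le' ee').
Qed.
Let sG := smooth_flat_image.

Lemma flat_image_lightlike u : lightlike (G u).
Proof. by apply: (proj1 isof); exact: horosphere_lightlike. Qed.
Let lG := flat_image_lightlike.

Lemma flat_image_iso u v w : mink ('D_v G u) ('D_w G u) = mink (P v) (P w).
Proof.
have [_ iso] := (proj2 isof) _ _ (smooth_horosphere e e') (horosphere_lightlike le le' ee').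
by have := iso u v w; rewrite horosphere_flat.
Qed.

Lemma flat_image_orth u v : mink ('D_v G u) (G u) = 0.
Proof. exact: plot_orth. Qed.

Lemma derive_flat_image_iso u a b c :
  mink ('D_a (fun x => 'D_b G x) u) ('D_c G u) +
  mink ('D_b G u) ('D_a (fun x => 'D_c G x) u) = 0.
Proof.
have := derive_pform (p := 1) u a (smooth_derive b sG) (smooth_derive c sG).
have -> : (fun u => mink ('D_b G u) ('D_c G u)) = fun=> mink (P b) (P c).
  by apply/funext => x; exact: flat_image_iso.
by rewrite derive_const => <-.
Qed.

Lemma second_derive_flat_image u v w :
  mink ('D_w (fun x => 'D_v G x) u) (G u) = - mink (P v) (P w).
Proof.
have := derive_pform (p := 1) u w (smooth_derive v sG) sG.
have -> : (fun u => mink ('D_v G u) (G u)) = fun=> 0.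
  by apply/funext => x; exact: flat_image_orth.
rewrite derive_const flat_image_iso => /esym/eqP; rewrite addr_eq0 => /eqP ->.
by [].
Qed.

(** The Christoffel symbols vanish: they are symmetric in the first two indices and,
    the induced metric being constant, antisymmetric in the last two. *)
Lemma flat_christoffel u a b c :
  mink ('D_a (fun x => 'D_b G x) u) ('D_c G u) = 0.
Proof.
pose T a b c := mink ('D_a (fun x => 'D_b G x) u) ('D_c G u).
have Tsym x y z : T x y z = T y x z.
  exact: (congr1 (fun w => mink w ('D_z G u)) (deriveC u y x sG)).
have Tanti x y z : T x y z = - T x z y.
  apply/eqP; rewrite -addr_eq0 {2}/T (pformC 1 _ ('D_y G u)).
  by apply/eqP; exact: derive_flat_image_iso.
have h1 : T a b c = - T a c b := Tanti a b c.
have h2 : T a c b = T c a b := Tsym a c b.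
have h3 : T c a b = - T c b a := Tanti c a b.
have h4 : T c b a = T b c a := Tsym c b a.
have h5 : T b c a = - T b a c := Tanti b c a.
have h6 : T b a c = T a b c := Tsym b a c.
change (T a b c = 0).
move: h1 h2 h3 h4 h5 h6; move: (T a b c) (T a c b) (T c a b) (T c b a) (T b c a) (T b a c).
move=> x1 x2 x3 x4 x5 x6 h1 h2 h3 h4 h5 h6; move: h1.
rewrite h2 h3 h4 h5 h6 !opprK => /eqP.
by rewrite -addr_eq0 -mulr2n mulrn_eq0 => /eqP.
Qed.

(** The Gauss equation for a flat submanifold: differentiate [flat_christoffel] once
    more and use the symmetry of third derivatives. *)
Lemma flat_gauss u a b c d :
  mink ('D_a (fun x => 'D_b G x) u) ('D_d (fun x => 'D_c G x) u) =
  mink ('D_d (fun x => 'D_b G x) u) ('D_a (fun x => 'D_c G x) u).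
Proof.
have K x y : 'D_x (fun u => mink ('D_y (fun z => 'D_b G z) u) ('D_c G u)) u = 0.
  have -> : (fun u => mink ('D_y (fun z => 'D_b G z) u) ('D_c G u)) = fun=> 0.
    by apply/funext => z; exact: flat_christoffel.
  exact: derive_const.
have Ld := derive_pform (p := 1) u d (smooth_derive a (smooth_derive b sG)) (smooth_derive c sG).
have La := derive_pform (p := 1) u a (smooth_derive d (smooth_derive b sG)) (smooth_derive c sG).
have C := deriveC u a d (smooth_derive b sG).
have E := congr1 (fun w => mink w ('D_c G u)) C.
have H := etrans (etrans (esym Ld) (etrans (K d a) (etrans (esym (K a d)) La)))
  (congr1 (fun t => t + _) (esym E)).
exact: (addrI _ H).
Qed.

Lemma flat_image_normal_null u (y : V) : mink y (G u) = 0 ->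
  (forall v, mink y ('D_v G u) = 0) -> mink y y = 0.
Proof.
move=> yG yD; have dG := smooth_differentiable u sG.
apply: (normal_plane_orth_null le le' ee' (A := 'd G u) (lG u)) => //.
- by move=> v w; rewrite -!deriveE //; exact: flat_image_iso.
- by move=> v; rewrite -deriveE //; exact: flat_image_orth.
- by move=> v; rewrite -deriveE //; exact: yD.
Qed.

Lemma laplacian_flat_image (e1 e2 z u : V) :
    P e1 = e1 -> P e2 = e2 -> mink e1 e1 = 1 -> mink e2 e2 = 1 -> mink e1 e2 = 0 ->
    lightlike z ->
  mink ('D_e1 (fun x => 'D_e1 G x) u + 'D_e2 (fun x => 'D_e2 G x) u) z <= 0.
Proof.
move=> P1 P2 e11 e22 e12 lz.
have GA := second_derive_flat_image u e1 e1; rewrite P1 e11 in GA.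
have GB := second_derive_flat_image u e2 e2; rewrite P2 e22 in GB.
have GC := second_derive_flat_image u e1 e2; rewrite P1 P2 e12 oppr0 in GC.
have TA c := flat_christoffel u e1 e1 c.
have TB c := flat_christoffel u e2 e2 c.
have TC c := flat_christoffel u e2 e1 c.
have gauss := flat_gauss u e1 e1 e2 e2.
have sym := deriveC u e2 e1 sG.
apply: (null_laplacian (lG u) lz _ GA GB GC TA TB TC (etrans gauss (congr1 _ sym))).
exact: flat_image_normal_null.
Qed.

(** For null vectors -2 <x,y> = <x - y, x - y>, so this says that [G] is isometric to
    first order at 0. *)
Lemma flat_image_near0 (e1 e2 : V) (eps : R) :
    P e1 = e1 -> P e2 = e2 -> mink e1 e1 = 1 -> mink e2 e2 = 1 -> mink e1 e2 = 0 ->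
    0 < eps ->
  exists2 d, 0 < d & forall s t, `|s *: e1 + t *: e2| < d ->
    - 2 * mink (G (s *: e1 + t *: e2)) (G 0) <=
    s ^+ 2 + t ^+ 2 + eps * `|s *: e1 + t *: e2| ^+ 2.
Proof.
move=> P1 P2 e11 e22 e12 eps0.
have dG := smooth_differentiable 0 sG.
have [d d0 Hd] := pform_first_order 1 dG eps0.
exists d => // s t /Hd; set w := s *: e1 + t *: e2.
have -> : mink ('d G 0 w) ('d G 0 w) = s ^+ 2 + t ^+ 2.
  rewrite -!deriveE // flat_image_iso.
  have -> : P w = w by rewrite /w screenD !screenZ P1 P2.
  by rewrite /w !pform_linear (pformC 1 e2 e1) e11 e22 e12; ring.
apply: le_trans; rewrite pformBl !pformBr (proj1 (lG w)) (proj1 (lG 0)).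
by rewrite (pformC 1 (G 0)) le_eqVlt; apply/orP; left; apply/eqP; ring.
Qed.

End Screen.

(** The behaviour at infinity. By inversion and homogeneity the left-hand side is
    q/2 times the same expression for the horosphere based at [e'], taken at the
    point w = 2u/q with q = <u,u>; there [flat_image_near0] applies, with <w,w> = 4/q. *)
Lemma horosphere_plane_bound (e e' e1 e2 : V) (eps : R) :
    lightlike e -> lightlike e' -> mink e e' = -1 ->
    screen e e' e1 = e1 -> screen e e' e2 = e2 ->
    mink e1 e1 = 1 -> mink e2 e2 = 1 -> mink e1 e2 = 0 -> 0 < eps ->
  exists2 rho, 0 < rho & forall s t : R, rho <= Num.max `|s| `|t| ->
    - mink (f (horosphere e e' (s *: e1 + t *: e2))) (f e') <= 1 + eps.
Proof.
move=> le le' ee' P1 P2 e11 e22 e12 eps0.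
have e'e : mink e' e = -1 by rewrite pformC.
have swap v : screen e' e v = screen e e' v.
  by rewrite /screen addrAC.
have Q1 : screen e' e e1 = e1 by rewrite swap.
have Q2 : screen e' e e2 = e2 by rewrite swap.
pose a := `|e1| + `|e2|; have a0 : 0 <= a by rewrite addr_ge0.
have a1 : 0 < a ^+ 2 + 1 by rewrite ltr_wpDl // sqr_ge0.
have eps1 : 0 < eps / (a ^+ 2 + 1) by rewrite divr_gt0.
have [d d0 Hd] := flat_image_near0 le' le e'e Q1 Q2 e11 e22 e12 eps1.
exists (2 * (a + 1) / d); first by rewrite divr_gt0 // mulr_gt0 // ltr_wpDl.
move=> s t; set mu := Num.max `|s| `|t| => Hmu.
have mu0 : 0 < mu by apply: lt_le_trans Hmu; rewrite divr_gt0 // mulr_gt0 // ltr_wpDl.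
have smu : `|s| <= mu by rewrite le_max lexx.
have tmu : `|t| <= mu by rewrite le_max lexx orbT.
pose q := s ^+ 2 + t ^+ 2.
have muq : mu ^+ 2 <= q.
  rewrite /mu /q maxEle; case: ifP => _; rewrite real_normK ?num_real //.
    by rewrite lerDr sqr_ge0.
  by rewrite lerDl sqr_ge0.
have q0 : 0 < q by apply: lt_le_trans muq; rewrite exprn_gt0.
set u := s *: e1 + t *: e2.
have uu : mink u u = q.
  by rewrite /u !pform_linear (pformC 1 e2 e1) e11 e22 e12 /q; ring.
have Pu : screen e e' u = u by rewrite /u screenD !screenZ P1 P2.
rewrite (horosphere_inversion Pu) uu; last by rewrite gt_eqF.
have lh := horosphere_lightlike le' le e'e ((2 / q) *: u).
rewrite (homogeneous n3 isof lh) ?divr_gt0 // pformZl.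
have wE : (2 / q) *: u = (2 / q * s) *: e1 + (2 / q * t) *: e2.
  by rewrite /u scalerDr !scalerA.
have nu : `|u| <= a * mu.
  apply: le_trans (ler_normD _ _) _; rewrite !normrZ /a mulrDl.
  by apply: lerD; rewrite mulrC; apply: ler_wpM2l.
have nw : `|(2 / q) *: u| <= 2 / q * (a * mu).
  by rewrite normrZ gtr0_norm ?divr_gt0 //; apply: ler_wpM2l nu; rewrite ltW ?divr_gt0.
have wd : `|(2 / q) *: u| < d.
  apply: le_lt_trans nw _; apply: (@le_lt_trans _ _ (2 * a / mu)).
    rewrite (_ : 2 / q * (a * mu) = 2 * a * mu / q); last by ring.
    rewrite ler_pdivrMr // (_ : 2 * a / mu * q = 2 * a * (q / mu)); last by ring.
    by apply: ler_wpM2l; rewrite ?mulr_ge0 // ler_pdivlMr // -expr2.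
  rewrite ltr_pdivrMr //; apply: (@lt_le_trans _ _ (2 * (a + 1))); first by lra.
  by move: Hmu; rewrite ler_pdivrMr // (mulrC mu).
have := Hd (2 / q * s) (2 / q * t); rewrite -wE => /(_ wd).
rewrite {1 2}/flat_image horosphere0.
have -> : (2 / q * s) ^+ 2 + (2 / q * t) ^+ 2 = 4 / q.
  by rewrite (_ : _ + _ = (2 / q) ^+ 2 * q); [field; rewrite gt_eqF|rewrite /q; ring].
move: (mink _ _) => x Hx.
have nw2 : `|(2 / q) *: u| ^+ 2 <= a ^+ 2 * (4 / q).
  apply: (@le_trans _ _ ((2 / q * (a * mu)) ^+ 2)).
    rewrite lerXn2r ?nnegrE //.
    by apply: mulr_ge0; [rewrite ltW ?divr_gt0|rewrite mulr_ge0 // ltW].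
  rewrite (_ : (2 / q * (a * mu)) ^+ 2 = a ^+ 2 * (4 / q) * (mu ^+ 2 / q)); last first.
    by field; rewrite gt_eqF.
  apply: ler_piMr; first by rewrite mulr_ge0 ?sqr_ge0 // ltW // divr_gt0.
  by rewrite ler_pdivrMr // mul1r.
have {}Hx : - 2 * x <= 4 / q * (1 + eps).
  apply: le_trans Hx _; rewrite mulrDr mulr1 lerD2l.
  apply: (@le_trans _ _ (eps / (a ^+ 2 + 1) * (a ^+ 2 * (4 / q)))).
    by apply: ler_wpM2l nw2; rewrite ltW.
  rewrite mulrA mulrC; apply: ler_wpM2l; first by rewrite ltW // divr_gt0.
  rewrite mulrAC ler_pdivrMr // ler_pM2l //; lra.
have -> : - (q / 2 * x) = q / 4 * (- 2 * x) by field.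
have -> : 1 + eps = q / 4 * (4 / q * (1 + eps)) by field; rewrite gt_eqF.
by apply: ler_wpM2l Hx; rewrite ltW // divr_gt0.
Qed.

Lemma null_pair_bound (e e' : V) : lightlike e -> lightlike e' -> mink e e' = -1 ->
  - mink (f e) (f e') <= 1.
Proof.
move=> le le' ee'.
have [e1 [e2 [P1 P2 e11 e22 e12]]] := screen_frame le ee' n3.
pose G := flat_image e e'; have sG : smooth setT G by exact: smooth_flat_image.
have sz : smooth (setT : set V) (fun=> - f e') by exact: smooth_cst.
pose h u := mink (G u) (- f e').
have sh : smooth setT h by exact: smooth_pform.
have Dh v (F : V -> V) u : smooth setT F ->
    'D_v (fun u => mink (F u) (- f e')) u = mink ('D_v F u) (- f e').
  by move=> sF; rewrite derive_pform // derive_const (pformC 1 (F u) 0) pform0l addr0.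
have DDh v u : 'D_v (fun x => 'D_v h x) u = mink ('D_v (fun x => 'D_v G x) u) (- f e').
  have -> : (fun x => 'D_v h x) = fun x => mink ('D_v G x) (- f e').
    by apply/funext => x; exact: Dh.
  by apply: Dh; exact: smooth_derive.
have : h 0 <= 1.
  apply: (plane_maximum_principle (e1 := e1) (e2 := e2) sh) => [u|eps eps0].
    have lap := laplacian_flat_image le le' ee' u P1 P2 e11 e22 e12 (proj1 isof _ le').
    have := DDh e1 u; have := DDh e2 u; move: lap.
    rewrite -/G -oppr_ge0 -pformNr pformDl.
    move=> lap h2 h1.
    exact: (eq_ind_r (fun t => 0 <= t) lap (congr2 (fun s t : R => s + t) h1 h2)).
  have [rho rho0 Hrho] := horosphere_plane_bound le le' ee' P1 P2 e11 e22 e12 eps0.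
  by exists rho => // s t /Hrho; rewrite /h pformNr.
by rewrite /h pformNr /G /flat_image horosphere0.
Qed.

Lemma mink_bound x y : lightlike x -> lightlike y -> mink x y <= mink (f x) (f y).
Proof.
move=> lx ly; have := lightlike_mink_le0 lx ly.
rewrite le_eqVlt => /orP[/eqP xy0|xy0].
  have xE := lightlike_orth_eq ly xy0 (proj1 lx).
  have c0 : 0 < x ord0 0 / y ord0 0 by apply: divr_gt0; [case: lx|case: ly].
  rewrite xy0 xE (homogeneous n3 isof) // pformZl.
  by rewrite (proj1 (proj1 isof _ ly)) mulr0.
pose a := - mink x y; have a0 : 0 < a by rewrite /a oppr_gt0.
have ai0 : 0 < a^-1 by rewrite invr_gt0.
have lay := lightlikeZ ai0 ly.
have xay : mink x (a^-1 *: y) = -1.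
  by rewrite pformZr /a; field; rewrite lt_eqF.
have := null_pair_bound lx lay xay.
rewrite (homogeneous n3 isof) // pformZr -mulrN mulrC ler_pdivrMr // mul1r /a.
by rewrite lerN2.
Qed.

End Contraction.
(** * From curves to smooth families *)

Section CurvesToPlots.
Context {R : realType}.

Lemma class_C_line (V : normedModType R) m (f : V -> 'cV[R]_m.+1) u v k :
  smooth setT f -> class_C k (setT : set R^o) (fun t : R^o => f (u + t *: v)).
Proof.
have cl : continuous (fun t : R^o => u + t *: v).
  by move=> t; apply: cvgD; [exact: cvg_cst|apply: cvgZr_tmp; exact: cvg_id].
elim: k f => [|k IH] f sf.
  move=> t _; apply: (@continuous_comp _ _ _ _ f t (cl t)).
  exact: smooth_continuous.
have dc (t : R^o) : derivable (fun t : R => f (u + t *: v)) t 1.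
  by have [] := is_derive_line u v t sf.
split=> [t _|w]; first exact/derivable1_diffP/dc.
apply: (@eq_class_C _ _ _ _ _
   (fun t : R^o => w *: (fun x => 'D_v f x) (u + t *: v))) => [|t _|].
- exact: openT.
- rewrite deriv1E; last exact: dc.
  by rewrite derive1E; have [_ ->] := is_derive_line u v t sf.
apply: (@class_C_linl _ _ _ _ _ _ ( *:%R w : {linear 'cV[R]_m.+1 -> 'cV[R]_m.+1})).
- exact: openT.
- exact: scaler_continuous.
exact: (IH _ (smooth_derive v sf)).
Qed.

Lemma derive1_line (V : normedModType R) m (f : V -> 'cV[R]_m.+1) u v :
  smooth setT f -> derive1 (fun t : R => f (u + t *: v)) 0 = 'D_v f u.
Proof.
move=> sf; rewrite derive1E; have [_ ->] := is_derive_line u v 0 sf.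
by rewrite scale0r addr0.
Qed.

(** Each directional derivative of a smooth family in [S] is the velocity of a curve
    in [S], namely of the family along a line of parameters. *)
Lemma isometry_plot p m (S : set 'cV[R]_m.+1) f :
  isometry_of p S f -> plot_isometry p S f.
Proof.
move=> [[g [[fS gS] _ _ sf _]] iso]; split; first exact: fS.
move=> V0 psi spsi Spsi.
have sfpsi : smooth setT (fun u => f (psi u)) by exact: smooth_on_comp sf spsi Spsi.
split; first exact: sfpsi.
move=> u v w; have dif z : differential S f (psi u) ('D_z psi u) ('D_z (fun u => f (psi u)) u).
  exists (fun t : R => psi (u + t *: z)).
    split; first by rewrite scale0r addr0.
    exists 1; first exact: ltr01.
    split=> [k|t _]; last exact: Spsi.
    exact: (class_C_sub (@subsetT _ _) (class_C_line u z k spsi)).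
  by split; exact: derive1_line.
exact: iso (Spsi u) (dif v) (dif w).
Qed.

(** If [psi] is a family in [S] then so is [g \o psi], and [f] is isometric on it. *)
Lemma isometry_inverse_plot p m (S : set 'cV[R]_m.+1) f : isometry_of p S f ->
  exists2 g, plot_isometry p S g & forall x, S x -> g (f x) = x.
Proof.
move=> isof; have [fS pf] := isometry_plot isof.
have [[g [[_ gS] gf fg _ sg]] _] := isof.
exists g => //; split; first exact: gS.
move=> V0 psi spsi Spsi.
have sgpsi : smooth setT (fun u => g (psi u)) by exact: smooth_on_comp sg spsi Spsi.
split; first exact: sgpsi.
move=> u v w; have [_ isog] := pf V0 _ sgpsi (fun u => gS _ (Spsi u)).
have E : (fun u => f (g (psi u))) = psi by apply/funext => x; exact/fg/Spsi.
by have := isog u v w; rewrite E => ->.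
Qed.

End CurvesToPlots.

(** * Extension to a Lorentz transformation *)

Section LinearExtension.
Context {R : realType} {n : nat}.
Local Notation V := 'cV[R]_n.+1.
Local Notation mink := (@pform R 1 n.+1).

Lemma pform_sumr p (I : finType) (x : V) (a : I -> R) (y : I -> V) :
  pform p x (\sum_i a i *: y i) = \sum_i a i * pform p x (y i).
Proof.
apply: (big_ind2 (fun u (r : R) => pform p x u = r)).
- by rewrite pformC pform0l.
- by move=> u r v s <- <-; rewrite pformDr.
by move=> i _; rewrite pformZr.
Qed.

Lemma mulmx_cols (t : 'I_n.+1 -> V) (v : V) :
  (\matrix_(a, i) t i a 0) *m v = \sum_i v i 0 *: t i.
Proof.
apply/colP => a; rewrite mxE summxE; apply: eq_bigr => i _.
by rewrite !mxE mulrC.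
Qed.

(** Basis vectors as half-sums and half-differences of the null vectors
    E_0 + E_j and E_0 - E_j. *)
Lemma lightlike_span (i : 'I_n.+1) : (0 < n)%N -> exists q : (V * V) * (R * R),
  [/\ lightlike q.1.1, lightlike q.1.2 &
      delta_mx i 0 = q.2.1 *: q.1.1 + q.2.2 *: q.1.2].
Proof.
move=> n0; pose E (j : 'I_n.+1) : V := delta_mx j 0.
have EE j k : mink (E j) (E k) = (if j == ord0 then -1 else 1) * (j == k)%:R.
  rewrite pformE (bigD1 j) //= big1 => [|l lj]; last first.
    by rewrite !mxE (negbTE lj) mul0r mulr0.
  rewrite !mxE eqxx addr0 mul1r; congr (_ * _); last by rewrite andbT.
  by congr (if _ then _ else _); case: j => [[|j] jn].
have Ll (j : 'I_n) (s : R) : s * s = 1 -> lightlike (E ord0 + s *: E (lift ord0 j)).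
  move=> ss; split; last by rewrite !mxE /=; lra.
  have j0 : (lift ord0 j == ord0) = false by [].
  rewrite !pform_linear !EE !eqxx (eq_sym ord0) j0 /=.
  rewrite (_ : _ + _ = s * s - 1); last by ring.
  by rewrite ss subrr.
pose j0 : 'I_n := Ordinal n0.
case: (unliftP ord0 i) => [j ->|->].
  exists ((E ord0 + 1 *: E (lift ord0 j), E ord0 + (-1) *: E (lift ord0 j)),
          (1 / 2, - 1 / 2)).
  split; [by apply: Ll; ring|by apply: Ll; ring|].
  rewrite /= -/(E _); move: (E _) (E _) => x y.
  by apply/colP => a; rewrite !mxE; field.
exists ((E ord0 + 1 *: E (lift ord0 j0), E ord0 + (-1) *: E (lift ord0 j0)),
        (1 / 2, 1 / 2)).
split; [by apply: Ll; ring|by apply: Ll; ring|].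
rewrite /= -/(E _); move: (E _) (E _) => x y.
by apply/colP => a; rewrite !mxE; field.
Qed.

Lemma eq_on_lightlike (A B : 'M[R]_n.+1) : (0 < n)%N ->
  (forall x : V, lightlike x -> A *m x = B *m x) -> A = B.
Proof.
move=> n0 AB; apply/matrixP => a i.
have [[[x y] [s t]] /= [lx ly E]] := lightlike_span i n0.
have : A *m delta_mx i (0 : 'I_1) = B *m delta_mx i 0.
  by rewrite E !mulmxDr -!scalemxAr !AB.
by rewrite -!colE => /colP/(_ a); rewrite !mxE.
Qed.

(** Define [tau] on the basis through [lightlike_span]. By bilinearity [f x] and
    [tau v] have the same product as [x] and [v], hence [tau] is a Lorentz
    transformation, and [f x - tau x] is orthogonal to the image of [tau], which is
    everything. *)
Lemma lightlike_isometry_linear (f : V -> V) : (0 < n)%N ->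
    (forall x, lightlike x -> lightlike (f x)) ->
    (forall x y, lightlike x -> lightlike y -> mink (f x) (f y) = mink x y) ->
  exists tau : 'M[R]_n.+1, lorentz_plus tau /\ forall x, lightlike x -> tau *m x = f x.
Proof.
move=> n0 fL fM.
have /choice [q qP] := fun i => lightlike_span i n0.
pose t i := (q i).2.1 *: f (q i).1.1 + (q i).2.2 *: f (q i).1.2.
pose tau : 'M[R]_n.+1 := \matrix_(a, i) t i a 0.
have ft x i : lightlike x -> mink (f x) (t i) = mink x (delta_mx i 0).
  move=> lx; have [l1 l2 ->] := qP i.
  by rewrite /t !(pformDr, pformZr) !fM.
have ftau x v : lightlike x -> mink (f x) (tau *m v) = mink x v.
  move=> lx; rewrite mulmx_cols pform_sumr [in RHS](cV_sum_delta v) pform_sumr.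
  by apply: eq_bigr => i _; rewrite ft.
have lor : lorentz tau.
  move=> u v; rewrite (mulmx_cols t u) pformC pform_sumr.
  rewrite [in RHS](cV_sum_delta u) [RHS]pformC pform_sumr; apply: eq_bigr => i _.
  have [l1 l2 ->] := qP i; congr (_ * _); rewrite pformC [RHS]pformC.
  by rewrite /t !(pformDl, pformZl) !ftau.
have tauf x : lightlike x -> tau *m x = f x.
  move=> lx; apply/eqP; rewrite -subr_eq0; apply/eqP/(@pform_eq0 _ _ 1) => v.
  have inj : injective (fun u : V => tau *m u).
    move=> u1 u2 uu; apply/eqP; rewrite -subr_eq0; apply/eqP/(@pform_eq0 _ _ 1) => w.
    by rewrite -lor mulmxBr uu subrr pform0l.
  have [u ->] := @linear_inj_surj R n (mulmx tau) inj v.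
  by rewrite pformBl lor ftau // subrr.
exists tau; split=> //; split=> // u uu u0.
have [l1 _ _] := qP ord0.
apply: (future_of_lightlike (fL _ l1)); first by rewrite lor ltW.
by rewrite -tauf // lor; exact: timelike_lightlike_lt0.
Qed.

End LinearExtension.

(** * The three models *)

Section Models.
Context {R : realType} {n : nat}.
Implicit Types (k : model).
Local Notation V := 'cV[R]_n.+1.
Local Notation mink := (@pform R 1 n.+1).

(** In each model the cone is the image of the null cone of R^{1,n} under the affine
    map x |-> chart x + base. *)
Definition chart k : 'M[R]_((ambient_pred k n).+1, n.+1) :=
  match k return 'M[R]_((ambient_pred k n).+1, n.+1) with
  | Minkowski => 1%:M
  | DeSitter => col_mx 1%:M 0 : 'M[R]_(n.+1 + 1, n.+1)
  | AntiDeSitter => col_mx 0 1%:M : 'M[R]_(1 + n.+1, n.+1)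
  end.

Definition base k : 'cV[R]_(ambient_pred k n).+1 :=
  match k return 'cV[R]_(ambient_pred k n).+1 with
  | Minkowski => 0
  | DeSitter => col_mx 0 1%:M : 'cV[R]_(n.+1 + 1)
  | AntiDeSitter => col_mx 1%:M 0 : 'cV[R]_(1 + n.+1)
  end.

Lemma chartK k (x : V) : (chart k)^T *m (chart k *m x + base k) = x.
Proof.
case: k => /=.
- by rewrite trmx1 !mul1mx addr0.
- change ((col_mx 1%:M 0 : 'M[R]_(n.+1 + 1, n.+1))^T *m
    ((col_mx 1%:M 0 : 'M[R]_(n.+1 + 1, n.+1)) *m x + col_mx 0 1%:M) = x).
  rewrite mul_col_mx mul1mx mul0mx add_col_mx addr0 add0r tr_col_mx mul_row_col.
  by rewrite trmx1 trmx0 mul1mx mul0mx addr0.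
change ((col_mx 0 1%:M : 'M[R]_(1 + n.+1, n.+1))^T *m
    ((col_mx 0 1%:M : 'M[R]_(1 + n.+1, n.+1)) *m x + col_mx 1%:M 0) = x).
rewrite mul_col_mx mul1mx mul0mx add_col_mx addr0 add0r tr_col_mx mul_row_col.
by rewrite trmx1 trmx0 mul1mx mul0mx add0r.
Qed.

Lemma pform_col_DeSitter (u v : V) (a b : 'cV[R]_1) :
  pform 1 (col_mx u a) (col_mx v b) = mink u v + a 0 0 * b 0 0.
Proof.
rewrite !pformE big_split_ord /= big_ord1; congr (_ + _).
  by apply: eq_bigr => i _; rewrite !col_mxEu.
by rewrite !col_mxEd mul1r.
Qed.

Lemma pform_col_AntiDeSitter (u v : V) (a b : 'cV[R]_1) :
  pform 2 (col_mx a u) (col_mx b v) = - (a 0 0 * b 0 0) + mink u v.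
Proof.
rewrite !pformE big_split_ord /= big_ord1; congr (_ + _).
  by rewrite !col_mxEu mulN1r.
by apply: eq_bigr => i _; rewrite !col_mxEd.
Qed.

Lemma pform_chart k (u v : V) :
  pform (negative_index k) (chart k *m u) (chart k *m v) = mink u v.
Proof.
case: k => /=.
- by rewrite !mul1mx.
- change (pform 1 ((col_mx 1%:M 0 : 'M[R]_(n.+1 + 1, n.+1)) *m u)
    ((col_mx 1%:M 0 : 'M[R]_(n.+1 + 1, n.+1)) *m v) = mink u v).
  by rewrite !mul_col_mx !mul1mx !mul0mx pform_col_DeSitter mxE mul0r addr0.
change (pform 2 ((col_mx 0 1%:M : 'M[R]_(1 + n.+1, n.+1)) *m u)
    ((col_mx 0 1%:M : 'M[R]_(1 + n.+1, n.+1)) *m v) = mink u v).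
by rewrite !mul_col_mx !mul1mx !mul0mx pform_col_AntiDeSitter mxE mul0r oppr0 add0r.
Qed.

Lemma chart_DeSitterE (x : V) : chart DeSitter *m x + base DeSitter =
  col_mx x (1%:M : 'cV[R]_1).
Proof.
change ((col_mx 1%:M 0 : 'M[R]_(n.+1 + 1, n.+1)) *m x + col_mx 0 1%:M =
  col_mx x (1%:M : 'cV[R]_1)).
by rewrite mul_col_mx mul1mx mul0mx add_col_mx addr0 add0r.
Qed.

Lemma chart_AntiDeSitterE (x : V) : chart AntiDeSitter *m x + base AntiDeSitter =
  col_mx (1%:M : 'cV[R]_1) x.
Proof.
change ((col_mx 0 1%:M : 'M[R]_(1 + n.+1, n.+1)) *m x + col_mx 1%:M 0 =
  col_mx (1%:M : 'cV[R]_1) x).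
by rewrite mul_col_mx mul1mx mul0mx add_col_mx addr0 add0r.
Qed.

Lemma future_cone_DeSitterE (x : V) (a : 'cV[R]_1) :
  future_cone R DeSitter n (col_mx x a) <-> lightlike x /\ a = 1%:M.
Proof.
rewrite /future_cone /= /spacetime /= /lightlike.
have -> : col_mx x a (ord_max : 'I_(n + 1).+1) 0 = a 0 0.
  have -> : ord_max = rshift n.+1 (ord0 : 'I_1) 
    by apply/val_inj; change ((n + 1)%N = (n.+1 + 0)%N); rewrite addn0 addn1.
  by rewrite col_mxEd.
have -> : col_mx x a (ord0 : 'I_(n + 1).+1) 0 = x ord0 0.
  have -> : (ord0 : 'I_(n + 1).+1) = lshift 1 (ord0 : 'I_n.+1) by exact/val_inj.
  by rewrite col_mxEu.
rewrite pform_col_DeSitter; split=> [[xa a1 x0]|[[xx x0] ->]].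
  split; last by apply/colP => i; rewrite ord1 a1 mxE.
  by split=> //; move: xa; rewrite a1 mulr1 => /(canRL (addrK _)); rewrite subrr.
by rewrite xx mxE mulr1 add0r.
Qed.

Lemma future_cone_AntiDeSitterE (x : V) (a : 'cV[R]_1) :
  future_cone R AntiDeSitter n (col_mx a x) <-> lightlike x /\ a = 1%:M.
Proof.
rewrite /future_cone /= /spacetime /= /lightlike.
have -> : col_mx a x (ord0 : 'I_(1 + n).+1) 0 = a 0 0.
  have -> : (ord0 : 'I_(1 + n).+1) = lshift n.+1 (ord0 : 'I_1) by exact/val_inj.
  by rewrite col_mxEu.
have -> : col_mx a x (lift (ord0 : 'I_(1 + n).+1) ord0) 0 = x ord0 0.
  have -> : lift (ord0 : 'I_(1 + n).+1) ord0 = rshift 1 (ord0 : 'I_n.+1).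
    exact/val_inj.
  by rewrite col_mxEd.
rewrite pform_col_AntiDeSitter; split=> [[xa a1 x0]|[[xx x0] ->]].
  split; last by apply/colP => i; rewrite ord1 a1 mxE.
  by split=> //; move: xa; rewrite a1 mulr1 => /(canRL (addKr _)); rewrite opprK subrr.
by rewrite xx mxE mulr1 addr0.
Qed.

Lemma future_coneE k (y : 'cV[R]_(ambient_pred k n).+1) :
  future_cone R k n y <-> exists2 x : V, lightlike x & y = chart k *m x + base k.
Proof.
case: k y => /= y.
- split=> [ly|[x lx ->]]; last by rewrite mul1mx addr0.
  by exists y; rewrite ?mul1mx ?addr0.
- split=> [|[x lx ->]]; last first.
    by rewrite chart_DeSitterE; apply/future_cone_DeSitterE.
  rewrite -(@vsubmxK _ n.+1 1 1 y) => /future_cone_DeSitterE[lx ->].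
  by exists (@usubmx _ n.+1 1 1 y); rewrite ?chart_DeSitterE.
split=> [|[x lx ->]]; last first.
  by rewrite chart_AntiDeSitterE; apply/future_cone_AntiDeSitterE.
rewrite -(@vsubmxK _ 1 n.+1 1 y) => /future_cone_AntiDeSitterE[lx ->].
by exists (@dsubmx _ 1 n.+1 1 y); rewrite ?chart_AntiDeSitterE.
Qed.

Lemma extend_chart k (tau : 'M[R]_n.+1) (x : V) :
  extend k tau *m (chart k *m x + base k) = chart k *m (tau *m x) + base k.
Proof.
case: k.
- by rewrite /= !mul1mx !addr0.
- rewrite !chart_DeSitterE.
  change ((block_mx tau 0 0 1%:M : 'M[R]_(n.+1 + 1)) *m col_mx x 1%:M =
    col_mx (tau *m x) (1%:M : 'cV[R]_1)).
  by rewrite mul_block_col !mul0mx mul1mx addr0 add0r.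
rewrite !chart_AntiDeSitterE.
change ((block_mx 1%:M 0 0 tau : 'M[R]_(1 + n.+1)) *m col_mx 1%:M x =
  col_mx (1%:M : 'cV[R]_1) (tau *m x)).
by rewrite mul_block_col !mul0mx mul1mx addr0 add0r.
Qed.

Lemma derive_mulmx (V0 : normedModType R) p q (A : 'M[R]_(p.+1, q.+1))
    (f : V0 -> 'cV[R]_q.+1) u v : smooth setT f ->
  'D_v (fun x => A *m f x) u = A *m 'D_v f u.
Proof.
move=> sf; have sA : smooth setT (mulmx A : 'cV[R]_q.+1 -> 'cV[R]_p.+1).
  exact: smooth_mulmx (@smooth_id R _).
have df := smooth_differentiable u sf.
rewrite deriveE; last exact: smooth_differentiable (smooth_mulmx A sf).
rewrite deriveE //.
have dA := smooth_differentiable (f u) sA.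
have E := diff_comp df dA.
have -> : 'd (fun x => A *m f x) u v = 'd (mulmx A : 'cV[R]_q.+1 -> 'cV[R]_p.+1) (f u) ('d f u v).
  exact: (congr1 (fun h : V0 -> 'cV[R]_p.+1 => h v) E).
by rewrite (diff_lin _ (smooth_continuous sA)).
Qed.

(** Since the columns of [chart k] are orthonormal for the Euclidean product, its
    transpose is a left inverse ([chartK]) and pulls the isometry back. *)
Lemma plot_isometry_chart k f :
  plot_isometry (negative_index k) (future_cone R k n) f ->
  plot_isometry 1 (@lightlike R n) (fun x => (chart k)^T *m f (chart k *m x + base k))
  /\ forall x : V, lightlike x ->
     chart k *m ((chart k)^T *m f (chart k *m x + base k)) + base k =
     f (chart k *m x + base k).
Proof.
move=> [fS iso].
have inS x : lightlike x -> future_cone R k n (chart k *m x + base k).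
  by move=> lx; apply/future_coneE; exists x.
have fE x : lightlike x -> exists2 y : V, lightlike y &
    f (chart k *m x + base k) = chart k *m y + base k.
  by move=> /inS/fS/future_coneE.
have fK x : lightlike x -> chart k *m ((chart k)^T *m f (chart k *m x + base k)) + base k =
     f (chart k *m x + base k).
  by move=> /fE[y ly ->]; rewrite chartK.
split=> //; split; first by move=> x /fE[y ly ->]; rewrite chartK.
move=> V0 psi spsi lpsi.
have sJ : smooth setT (fun u => chart k *m psi u) by exact: smooth_mulmx.
have sb : smooth (setT : set V0) (fun=> base k) by exact: smooth_cst.
have sJb : smooth setT (fun u => chart k *m psi u + base k) by exact: smoothD.
have [sf isof] := iso V0 _ sJb (fun u => inS _ (lpsi u)).
have sg : smooth setT (fun u => (chart k)^T *m f (chart k *m psi u + base k)).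
  exact: smooth_mulmx.
split; first exact: sg.
move=> u v w; apply: etrans (esym (pform_chart k _ _)) _.
apply: etrans _ (pform_chart k _ _).
have DJ z : 'D_z (fun u => chart k *m psi u + base k) u = chart k *m 'D_z psi u.
  by rewrite derive_add // derive_const addr0 derive_mulmx.
have Dg z : chart k *m 'D_z (fun u => (chart k)^T *m f (chart k *m psi u + base k)) u =
    'D_z (fun u => f (chart k *m psi u + base k)) u.
  rewrite -derive_mulmx //.
  rewrite -[LHS]addr0 -(derive_const (base k) u z) -derive_add //; last exact: smooth_mulmx.
  by congr ('D_z _ u); apply/funext => x; rewrite fK.
by rewrite (Dg v) (Dg w) (isof u v w) (DJ v) (DJ w).
Qed.

End Models.

(** * The theorem *)

Theorem theorem1p2 (R : realType) (n : nat) (hn : (3 <= n)%N) (k : model)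
    (phi : 'cV[R]_(ambient_pred k n).+1 -> 'cV[R]_(ambient_pred k n).+1)
    (hphi : isometry_of (negative_index k) (future_cone R k n) phi) :
  exists! tau : 'M[R]_n.+1,
    lorentz_plus tau /\
    forall x, future_cone R k n x -> extend k tau *m x = phi x.
Proof.
have n0 : (0 < n)%N by exact: leq_trans hn.
have [isof fK] := plot_isometry_chart (isometry_plot hphi).
have [psi psi_iso psiK] := isometry_inverse_plot hphi.
have [isog gK] := plot_isometry_chart psi_iso.
set f := (fun x : 'cV[R]_n.+1 => _) in isof fK.
set g := (fun x : 'cV[R]_n.+1 => _) in isog gK.
have fL := proj1 isof.
have gf x : lightlike x -> g (f x) = x.
  move=> lx; rewrite /g (fK x lx) psiK ?chartK //.
  by apply/future_coneE; exists x.
have fM x y : lightlike x -> lightlike y -> pform 1 (f x) (f y) = pform 1 x y.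
  move=> lx ly; apply/eqP; rewrite eq_le (mink_bound hn isof) // andbT.
  by have := mink_bound hn isog (fL _ lx) (fL _ ly); rewrite !gf.
have [tau [ltau tauE]] := lightlike_isometry_linear n0 fL fM.
exists tau; split.
  split=> // y /future_coneE[x lx ->].
  by rewrite extend_chart tauE // fK.
move=> tau' [_ tau'E]; apply: eq_on_lightlike n0 _ => x lx; rewrite tauE //.
have : extend k tau' *m (chart k *m x + base k) = phi (chart k *m x + base k).
  by apply: tau'E; apply/future_coneE; exists x.
by rewrite extend_chart => /(congr1 (mulmx (chart k)^T)); rewrite chartK => ->.
Qed.
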